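(* Let $w\in\{0,1\}^{\omega}$ be a recurrent infinite word over the binary alphabet $\{0,1\}$. Then $w$ is Sturmian if and only if each factor $u$ of $w$ has two or three semi-abelian returns in $w$.
   Context: For a finite alphabet $\Sigma$, $\Sigma^{\omega}$ is the set of right-infinite words $w=w_1w_2\cdots$ over $\Sigma$. A factor of $w$ is a finite word occurring as a block of consecutive letters of $w$. An infinite word is recurrent if each of its factors occurs in it infinitely many times. A Sturmian word is an infinite word having exactly $n+1$ distinct factors of length $n$ for every $n\ge 0$ (so it is a binary word; its letters are denoted $0,1$). For a finite word $u$ and a letter $a$, $|u|$ is the length of $u$ and $|u|_a$ the number of occurrences of $a$ in $u$. Two finite words $u,v$ are abelian equivalent, $u\sim_{ab}v$, if $|u|_a=|v|_a$ for all letters $a$. Semi-abelian returns: let $w$ be a recurrent infinite word, $u$ a factor of $w$, and let $n_1<n_2<n_3<\cdots$ be all the integers $n_i$ such that $w_{n_i}\cdots w_{n_i+|u|-1}\sim_{ab}u$. Each word $w_{n_i}\cdots w_{n_{i+1}-1}$, $i\ge1$, is a semi-abelian return to $u$ in $w$. The number of semi-abelian returns to $u$ is the number of distinct words arising in this way. *)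

(* Defs.v *)
From mathcomp Require Import all_boot.
From mathcomp Require Import boolp classical_sets functions cardinality.

Set Implicit Arguments.
Unset Strict Implicit.
Unset Printing Implicit Defensive.

Local Open Scope classical_set_scope.
Local Open Scope card_scope.

(* Right-infinite words are functions from nat, so letters are numbered from 0
   and the word w_1 w_2 w_3 ... of the literature is w 0, w 1, w 2, ... *)
Definition infinite_word (A : finType) : Type := nat -> A.

Definition block (A : finType) (w : infinite_word A) (n l : nat) : seq A :=
  mkseq (fun i => w (n + i)) l.

Definition occurs_at (A : finType) (w : infinite_word A) (u : seq A) (n : nat)
  : Prop := block w n (size u) = u.

(* The empty word is a factor of every infinite word. *)
Definition factor (A : finType) (w : infinite_word A) (u : seq A) : Prop :=
  exists n, occurs_at w u n.

Definition recurrent (A : finType) (w : infinite_word A) : Prop :=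
  forall u, factor w u -> infinite_set [set n | occurs_at w u n].

Definition sturmian (A : finType) (w : infinite_word A) : Prop :=
  forall n, [set u | factor w u /\ size u = n] #= `I_n.+1.

Definition abelian_equiv (A : finType) (u v : seq A) : Prop :=
  forall a, count_mem a u = count_mem a v.

Definition abelian_occurs_at (A : finType) (w : infinite_word A) (u : seq A)
  (n : nat) : Prop := abelian_equiv (block w n (size u)) u.

(* Here i and j are two consecutive terms n_k < n_(k+1) of the increasing
   enumeration of the abelian occurrences of u, and the return is the word
   w i, ..., w j.-1 between them. *)
Definition semi_abelian_return (A : finType) (w : infinite_word A)
  (u v : seq A) : Prop :=
  exists i j,
    [/\ i < j,
        abelian_occurs_at w u i,
        abelian_occurs_at w u j,
        (forall k, i < k < j -> ~ abelian_occurs_at w u k)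
      & v = block w i (j - i)].

Definition semi_abelian_returns (A : finType) (w : infinite_word A)
  (u : seq A) : set (seq A) := [set v | semi_abelian_return w u v].

(* Main.v *)
(* A Sturmian word is a balanced word having a right special factor of every length.
   In a balanced word the blocks of a given length have two weights, and the positions
   of light blocks form an initial segment for the lexicographic order of the suffixes.
   Two distinct returns to such a segment diverge either at a factor followed by both
   letters, or at a factor which is itself a return and which does not always return;
   each kind of divergence occurs at only one factor, so there are at most three returns.

   Conversely, let the blocks [0x0] and [1x1] of minimal length witness that w is not
   balanced. If x contains both letters then 0, 1, 01 and 10 are returns to the blocks
   of intermediate weight. Otherwise the returns at that length force one of the letters
   to have runs of a single length r, and the other to have two run lengths s < t, and
   then some abelian class of blocks has four returns, unless w is periodic in such a
   way that the maximal run has a single return. A balanced word without right special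
   factors of some length is periodic, and the factor leading from the least to the
   greatest of its suffixes has a single return. *)

Require Import Defs.
From mathcomp Require Import all_boot zify.
From mathcomp Require Import finmap boolp classical_sets functions cardinality.

Set Implicit Arguments.
Unset Strict Implicit.
Unset Printing Implicit Defensive.

Local Open Scope classical_set_scope.
Local Open Scope card_scope.

(** * Weights of blocks and returns *)

(** Over two letters an abelian class is a length and a weight, so everything is computed with the
    prefix sums [ones], and exchanging the letters mirrors each one-sided argument. Balance says
    that the prefix sums of two suffixes, once strictly compared, never cross; this is why weight
    and lexicographic order agree. That a Sturmian word is balanced is seen on a minimal pair 0x0,
    1x1: x is right special, so 0x or 1x is the right special factor of its length, say 0x. It
    begins nowhere in 1x1, hence the windows starting there must repeat, and the word continues
    periodically without 0x, against recurrence. For the converse, the difficulty is to find in each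
    configuration a length and a weight with four returns. They are tuned so that sliding the window
    by one letter keeps or breaks the weight according to which two runs or gaps follow each other.
    In some of these classes a return grows with the number of consecutive equal runs, so that two
    different numbers give two returns. *)

Lemma card_seq (T : choiceType) (A : set T) n :
  A #= `I_n <-> exists s : seq T, [/\ uniq s, size s = n & A = [set` s]].
Proof.
split=> [An|[s [us <- ->]]].
  have fA : finite_set A by exists n.
  exists (fset_set A); split; [exact: fset_uniq| exact: card_fset_set|].
  by rewrite -[LHS](fset_setK fA).
have -> : [set` s] = [set` [fset x in s]%fset].
  by apply/seteqP; split=> x /=; rewrite inE.
by apply/card_eq_fsetP; rewrite card_fseq undup_id.
Qed.

(** In this form the upper bound is refuted by four pairwise distinct elements, and no separate
    proof of finiteness is called for. *)
Lemma card_2_or_3 (T : choiceType) (A : set T) :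
  (A #= `I_2 \/ A #= `I_3) <->
  (exists a b, [/\ A a, A b & a <> b]) /\
  (forall a b c d, A a -> A b -> A c -> A d -> ~ uniq [:: a; b; c; d]).
Proof.
split=> [h|[[a [b [Aa Ab /eqP ab]]] h4]].
  have {h}[s [us ss ->]] : exists s : seq T, [/\ uniq s, 1 < size s < 4 & A = [set` s]].
    by case: h => /card_seq[s [us ss ->]]; exists s; rewrite us ss.
  split.
    case: s us ss => [//|a [//|b s]] /= /andP[]; rewrite inE negb_or => /andP[/eqP ab _] _ _.
    by exists a, b; rewrite !inE !eqxx orbT.
  move=> a b c d sa sb sc sd u4.
  have : size [:: a; b; c; d] <= size s.
    by apply: uniq_leq_size => // x; rewrite !inE => /or4P[] /eqP ->.
  by rewrite /=; lia.
case: (pselect (exists c, [/\ A c, c != a & c != b])) => [[c [Ac ca cb]]|no].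
  right; apply/card_seq; exists [:: a; b; c]; split=> //.
    by rewrite /= !inE negb_or ab [a == c]eq_sym ca [b == c]eq_sym cb.
  apply/seteqP; split=> x /=; rewrite !inE; last by case/or3P => /eqP ->.
  move=> Ax; apply/negPn/negP => /norP[xa /norP[xb xc]].
  apply: (h4 x a b c) => //=.
  by rewrite !inE !negb_or xa xb xc ab [a == c]eq_sym ca [b == c]eq_sym cb.
left; apply/card_seq; exists [:: a; b]; split=> //; first by rewrite /= inE ab.
apply/seteqP; split=> x /=; rewrite !inE; last by case/orP => /eqP ->.
by move=> Ax; apply/negPn/negP => /norP[xa xb]; apply: no; exists x.
Qed.

Section Basics.
Implicit Types (w : infinite_word bool) (i j k l c m n p q : nat).

Definition ones w n : nat := \sum_(i < n) w i.

Lemma onesS w n : ones w n.+1 = ones w n + w n.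
Proof. by rewrite /ones big_ord_recr. Qed.

Lemma ones_mono w n m : n <= m -> ones w n <= ones w m <= ones w n + (m - n).
Proof.
move=> /subnK <-; elim: (m - n) => [|d IH]; first by rewrite add0n; lia.
by rewrite addSn onesS; case: (w _) => /=; lia.
Qed.

Lemma ones_agree w n m p : (forall x, x < p -> w (n + x) = w (m + x)) ->
  forall j, j <= p -> ones w (n + j) + ones w m = ones w (m + j) + ones w n.
Proof.
move=> e; elim=> [|j IH] jp; first by rewrite !addn0 addnC.
rewrite !addnS !onesS (e j) //; have := IH (ltnW jp); lia.
Qed.

Lemma eq_blockP w n m l :
  block w n l = block w m l <-> (forall x, x < l -> w (n + x) = w (m + x)).
Proof.
split=> [e x xl|e].
  by have /(congr1 (fun s => nth false s x)) := e; rewrite !nth_mkseq.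
apply: (@eq_from_nth _ false); rewrite !size_mkseq // => x xl.
by rewrite !nth_mkseq // e.
Qed.

Lemma eq_block w n m l l' : block w n l = block w m l' ->
  l = l' /\ (forall x, x < l -> w (n + x) = w (m + x)).
Proof.
move=> e; have := congr1 size e; rewrite !size_mkseq => ll'.
by split => //; apply/eq_blockP; rewrite e ll'.
Qed.

Lemma count_block w n l : count_mem true (block w n l) + ones w n = ones w (n + l).
Proof.
elim: l => [|l IH]; first by rewrite addn0.
rewrite addnS onesS -IH /block /mkseq -addn1 iotaD map_cat count_cat /= add0n.
case: (w _) => /=; lia.
Qed.

Lemma abelian_occurs_ones w m l n :
  abelian_occurs_at w (block w m l) n <->
  ones w (n + l) + ones w m = ones w (m + l) + ones w n.
Proof.
have h k : count_mem false (block w k l) + count_mem true (block w k l) = l.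
  rewrite -[RHS](size_mkseq (fun i => w (k + i)) l) -(count_predC (pred1 true)) addnC.
  by congr addn; apply: eq_count => -[].
rewrite /abelian_occurs_at /abelian_equiv size_mkseq.
move: (count_block w n l) (count_block w m l) (h n) (h m).
set a := count _ _; set b := count _ _; set c := count _ _; set d := count _ _.
move=> ea eb ec ed; split=> [/(_ true)|e [|]]; rewrite -/a -/b -/c -/d; lia.
Qed.

(** An abelian class of binary blocks is the pair of a length [l] and a weight [c]; the return is
    the block from [i] to [j]. Weights are written additively because subtraction on [nat]
    truncates. *)
Definition weight_return w l c i j :=
  [/\ i < j, ones w (i + l) = ones w i + c, ones w (j + l) = ones w j + c
    & forall k, i < k < j -> ones w (k + l) <> ones w k + c].

Lemma weight_return_exists w l c i k : i < k ->
  ones w (i + l) = ones w i + c -> ones w (k + l) = ones w k + c ->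
  exists2 j, weight_return w l c i j & j <= k.
Proof.
move=> ik ci ck.
have ex : exists j, (i < j) && (ones w (j + l) == ones w j + c).
  by exists k; rewrite ik ck eqxx.
case: (ex_minnP ex) => j /andP[ij /eqP cj] jmin.
exists j; last by apply: jmin; rewrite ik ck eqxx.
split=> // q /andP[iq qj] cq.
by have := jmin q; rewrite iq cq eqxx => /(_ isT); lia.
Qed.

Definition two_or_three_returns w := forall l c,
  (exists m, ones w (m + l) = ones w m + c) ->
  (exists i j i' j', [/\ weight_return w l c i j, weight_return w l c i' j' &
                        block w i (j - i) <> block w i' (j' - i')]) /\
  (forall i1 j1 i2 j2 i3 j3 i4 j4,
     weight_return w l c i1 j1 -> weight_return w l c i2 j2 ->
     weight_return w l c i3 j3 -> weight_return w l c i4 j4 ->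
     ~ uniq [:: block w i1 (j1 - i1); block w i2 (j2 - i2);
               block w i3 (j3 - i3); block w i4 (j4 - i4)]).

Lemma recurrentP w : recurrent w -> forall n l N,
  exists2 m, N <= m & forall x, x < l -> w (m + x) = w (n + x).
Proof.
move=> rw n l N.
have fu : factor w (block w n l) by exists n; rewrite /occurs_at size_mkseq.
have inf := rw _ fu.
apply: contrapT => no; apply: inf.
apply: (@sub_finite_set _ _ `I_N); last exact: finite_II.
move=> m /= om; apply: contrapT => /negP; rewrite -leqNgt => Nm.
apply: no; exists m => //; apply/eq_blockP.
by move: om; rewrite /occurs_at size_mkseq.
Qed.

Lemma semi_abelian_return_ones w m l v :
  semi_abelian_return w (block w m l) v <->
  exists i j, weight_return w l (ones w (m + l) - ones w m) i j /\
              v = block w i (j - i).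
Proof.
have e n : abelian_occurs_at w (block w m l) n <->
    ones w (n + l) = ones w n + (ones w (m + l) - ones w m).
  by rewrite abelian_occurs_ones; have := @ones_mono w m (m + l); lia.
split=> [] [i [j]].
  case=> ij /e ci /e cj no ->; exists i, j; split=> //; split=> // k /no.
  by rewrite e.
by case=> -[ij /e ci /e cj no] ->; exists i, j; split=> // k /no; rewrite e.
Qed.

Lemma two_or_three_returnsP w : two_or_three_returns w <->
  (forall u, factor w u ->
     semi_abelian_returns w u #= `I_2 \/ semi_abelian_returns w u #= `I_3).
Proof.
split=> [h u [m]|h l c [m cm]].
  rewrite /occurs_at => <-; move: (size u) => l; apply/card_2_or_3.
  have [|[i [j [i' [j' [r r' rr']]]]] h4] := h l (ones w (m + l) - ones w m).
    by exists m; have := @ones_mono w m (m + l); lia.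
  split.
    exists (block w i (j - i)), (block w i' (j' - i')); split=> //.
      by apply/semi_abelian_return_ones; exists i, j.
    by apply/semi_abelian_return_ones; exists i', j'.
  move=> v1 v2 v3 v4 /semi_abelian_return_ones[i1 [j1 [r1 ->]]].
  move=> /semi_abelian_return_ones[i2 [j2 [r2 ->]]].
  move=> /semi_abelian_return_ones[i3 [j3 [r3 ->]]].
  move=> /semi_abelian_return_ones[i4 [j4 [r4 ->]]]; exact: h4.
have ec : c = ones w (m + l) - ones w m by lia.
have fu : factor w (block w m l) by exists m; rewrite /occurs_at size_mkseq.
have /card_2_or_3[[v1 [v2 [ra rb ab]]] h4] := h _ fu.
split.
  move: ra rb ab => /semi_abelian_return_ones[i1 [j1 [r1 ->]]].
  move=> /semi_abelian_return_ones[i2 [j2 [r2 ->]]] d.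
  by rewrite ec; exists i1, j1, i2, j2.
rewrite ec => i1 j1 i2 j2 i3 j3 i4 j4 r1 r2 r3 r4.
apply: h4; apply/semi_abelian_return_ones.
- by exists i1, j1.
- by exists i2, j2.
- by exists i3, j3.
- by exists i4, j4.
Qed.

End Basics.

(** * Right special factors *)

Section Complexity.
Variable w : infinite_word bool.

Definition right_special p n m :=
  [/\ forall x, x < p -> w (n + x) = w (m + x), w (n + p) = false
    & w (m + p) = true].

Definition factors p : {set p.-tuple bool} := finset (fun t : p.-tuple bool => `[< factor w t >]).

Definition prolongable p a : {set p.-tuple bool} :=
  finset (fun t : p.-tuple bool => [tuple of rcons t a] \in factors p.+1).

Lemma blockS n p : block w n p.+1 = rcons (block w n p) (w (n + p)).
Proof. by rewrite /block /mkseq -addn1 iotaD map_cat /= add0n cats1. Qed.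

Lemma factorsP p (t : p.-tuple bool) :
  reflect (exists n, block w n p = t) (t \in factors p).
Proof.
rewrite inE; apply: (iffP (asboolP _)) => -[n]; rewrite /occurs_at ?size_tuple.
  by exists n.
by exists n; rewrite /occurs_at size_tuple.
Qed.

Lemma prolongableP p a (t : p.-tuple bool) :
  reflect (exists2 n, block w n p = t & w (n + p) = a) (t \in prolongable p a).
Proof.
rewrite inE; apply: (iffP (factorsP _)) => [[n]|[n e wa]]; last first.
  by exists n; rewrite blockS e wa.
by rewrite blockS /= => /rcons_inj[e wa]; exists n.
Qed.

(** A factor extends to the right by one letter or, when it is right special, by both. The factors
    of length [p.+1] are counted by their last letter, and inclusion-exclusion does the rest. *)
Lemma card_factorsS p :
  #|factors p.+1| = #|factors p| + #|prolongable p false :&: prolongable p true|.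
Proof.
have -> : factors p = prolongable p false :|: prolongable p true.
  apply/setP => t; rewrite finset.in_setU; apply/factorsP/orP => [[n e]|].
    by case wa: (w (n + p)); [right|left]; apply/prolongableP; exists n.
  by case=> /prolongableP[n e _]; exists n.
rewrite cardsUI.
have rI a : injective (fun t : p.-tuple bool => [tuple of rcons t a]).
  by move=> t u /(congr1 val)/rcons_inj[/val_inj].
rewrite -(card_imset _ (rI false)) -(card_imset (mem (prolongable p true)) (rI true)).
rewrite -cardsUI [X in _ + #|pred_of_set X|](_ : _ = finset.set0) ?cards0 ?addn0.
  apply: eq_card => t; rewrite finset.in_setU; apply/factorsP/orP => [[n e]|]; last first.
    case=> /imsetP[u /prolongableP[n e wa] ->]; exists n.
      by rewrite blockS e wa.
    by rewrite blockS e wa.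
  have sz : size (block w n p) == p by rewrite size_mkseq.
  case wa: (w (n + p)); [right|left]; apply/imsetP; exists (Tuple sz).
  - by apply/prolongableP; exists n.
  - by apply: val_inj; rewrite /= -e blockS wa.
  - by apply/prolongableP; exists n.
  - by apply: val_inj; rewrite /= -e blockS wa.
apply/setP => t; rewrite !inE; apply/negP => /andP[/imsetP[u _ ->] /imsetP[v _]].
by move=> /(congr1 val)/rcons_inj[].
Qed.

Lemma card_factors0 : #|factors 0| = 1.
Proof.
rewrite -[RHS](expn0 #|{: bool}|) -card_tuple; apply: eq_card => t.
by rewrite tuple0 [RHS]inE; apply/factorsP; exists 0.
Qed.

Lemma card_factors p : [set u | factor w u /\ size u = p] #= `I_#|factors p|.
Proof.
apply/card_seq; exists (map val (enum (factors p))); split.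
- by rewrite map_inj_uniq ?enum_uniq //; exact: val_inj.
- by rewrite size_map -cardE.
apply/seteqP; split=> u /=.
  case=> fu /eqP su; apply/mapP; exists (Tuple su) => //.
  by rewrite mem_enum inE; apply/asboolP.
move=> /mapP[t]; rewrite mem_enum inE => /asboolP ft ->.
by rewrite size_tuple.
Qed.

Lemma sturmian_card : sturmian w <-> forall p, #|factors p| = p.+1.
Proof.
split=> h p.
  by apply/card_eq_II; rewrite -(card_eql (card_factors p)) h.
by rewrite -(h p) card_factors.
Qed.

Lemma right_special_prolongable p n m : right_special p n m ->
  exists2 t : p.-tuple bool,
    t \in prolongable p false :&: prolongable p true & block w n p = t.
Proof.
case=> e wn wm; have sz : size (block w n p) == p by rewrite size_mkseq.
exists (Tuple sz) => //; rewrite inE; apply/andP; split; apply/prolongableP.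
  by exists n.
by exists m => //; apply/eq_blockP => x xp; rewrite e.
Qed.

Lemma sturmianP : sturmian w <->
  forall p, (exists n m, right_special p n m) /\
    (forall n m n' m', right_special p n m -> right_special p n' m' ->
      forall x, x < p -> w (n + x) = w (n' + x)).
Proof.
rewrite sturmian_card; split=> [h p|h].
  have /eqP/cards1P[t et] : #|prolongable p false :&: prolongable p true| = 1.
    by have := card_factorsS p; rewrite !h; lia.
  split.
    have : t \in prolongable p false :&: prolongable p true by rewrite et inE.
    rewrite inE => /andP[/prolongableP[n en wn] /prolongableP[m em wm]].
    by exists n, m; split=> //; apply/eq_blockP; rewrite en em.
  move=> n m n' m' /right_special_prolongable[u] + eu.
  rewrite et inE => /eqP ut /right_special_prolongable[v] + ev.
  by rewrite et inE => /eqP vt; apply/eq_blockP; rewrite eu ev ut vt.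
elim=> [|p IH]; first exact: card_factors0.
have [[n [m rs]] un] := h p.
apply/eqP; rewrite card_factorsS IH -[p.+2]addn1 eqn_add2l; apply/cards1P.
have [t th te] := right_special_prolongable rs.
exists t; apply/eqP; rewrite finset.eqEsubset finset.sub1set th andbT.
apply/fintype.subsetP => u; rewrite finset.in_setI finset.in_set1.
move=> /andP[/prolongableP[n1 e1 wn1] /prolongableP[m1 e2 wm1]].
apply/eqP/val_inj; rewrite /= -e1 -te; apply/eq_blockP.
by apply: (un _ m1 _ m) => //; split=> //; apply/eq_blockP; rewrite e1 e2.
Qed.

(** There are [p.+1] factors of length [p] and one of them is right special, so [p.+1] windows
    avoiding it share [p] values. *)
Lemma right_special_pigeonhole p n : sturmian w ->
  (forall i n' m', i <= p -> right_special p n' m' ->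
     block w n' p <> block w (n + i) p) ->
  exists i j, i < j <= p /\ block w (n + i) p = block w (n + j) p.
Proof.
move=> /sturmian_card st H.
pose f (i : 'I_p.+1) : p.-tuple bool := Tuple (introT eqP (size_mkseq (fun x => w (n + i + x)) p)).
have bf (i : 'I_p.+1) : block w (n + i) p = f i by [].
have rs1 : #|prolongable p false :&: prolongable p true| = 1.
  by have := card_factorsS p; rewrite !st; lia.
have fF i : f i \in factors p :\: (prolongable p false :&: prolongable p true).
  rewrite finset.in_setD; apply/andP; split; last by apply/factorsP; exists (n + i).
  apply/negP; rewrite finset.in_setI => /andP[/prolongableP[n' en wn] /prolongableP[m' em wm]].
  apply: (H i n' m'); [by rewrite -ltnS| |by rewrite en].
  by split=> //; apply/eq_blockP; rewrite en em.
have cF : #|factors p :\: (prolongable p false :&: prolongable p true)| = p.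
  rewrite cardsD; set I := (X in _ - #|pred_of_set X|).
  have -> : I = prolongable p false :&: prolongable p true.
    apply/finset.setIidPr/fintype.subsetP => t; rewrite finset.in_setI => /andP[/prolongableP[m e _] _].
    by apply/factorsP; exists m.
  by rewrite rs1 st subn1.
have /injectivePn[i [j ij fij]] : ~~ injectiveb f.
  apply/negP => /injectiveP inj_f.
  have : #|f @: [set: 'I_p.+1]%SET| <= p.
    rewrite -[X in _ <= X]cF; apply: subset_leq_card; apply/fintype.subsetP => _ /imsetP[i _ ->].
    exact: fF.
  by rewrite card_imset // cardsT card_ord ltnn.
have e : block w (n + i) p = block w (n + j) p by rewrite !bf fij.
have ijn : (i : nat) != j by apply: contra ij => /eqP/val_inj ->.
case: (ltngtP i j) ijn => // lij _; [exists i, j|exists j, i]; split=> //.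
  by rewrite lij -ltnS /=.
by rewrite lij -ltnS /=.
Qed.

End Complexity.

(** * Balanced words *)

Section Balance.
Implicit Types (w : infinite_word bool) (i j k l c m n p q : nat).

Definition complement w : infinite_word bool := fun n => ~~ w n.

Lemma ones_complement w n : ones (complement w) n + ones w n = n.
Proof.
elim: n => [|n IH]; first by rewrite /ones !big_ord0.
by rewrite !onesS [complement w n]/(~~ w n); case: (w n) => /=; lia.
Qed.

Definition balanced w := forall l n m,
  ones w (n + l) + ones w m <= ones w (m + l) + ones w n + 1.

Lemma balanced_complement w : balanced w -> balanced (complement w).
Proof.
move=> b l n m; move: (b l m n) (ones_complement w n) (ones_complement w m)
  (ones_complement w (n + l)) (ones_complement w (m + l)); lia.
Qed.

Lemma block_complement w n l : block (complement w) n l = map negb (block w n l).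
Proof. by rewrite /block /mkseq -map_comp. Qed.

Lemma complementK w : complement (complement w) = w.
Proof. by apply/funext => n; rewrite /complement negbK. Qed.

Lemma weight_return_complement w l c i j : weight_return (complement w) l c i j ->
  weight_return w l (l - c) i j.
Proof.
have h n : ones (complement w) (n + l) = ones (complement w) n + c <->
     ones w (n + l) = ones w n + (l - c) /\ c <= l.
  move: (ones_complement w n) (ones_complement w (n + l)).
  move: (@ones_mono w n (n + l)) (@ones_mono (complement w) n (n + l)); lia.
case=> ij /h[ci cl] /h[cj _] no; split=> // k /no nk ck; apply: nk.
by apply/h; split.
Qed.

Lemma two_or_three_complement w :
  two_or_three_returns w -> two_or_three_returns (complement w).
Proof.
move=> h l c [m cm].
have cl : c <= l by have := @ones_mono (complement w) m (m + l); lia.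
have back i j : weight_return w l (l - c) i j -> weight_return (complement w) l c i j.
  rewrite -{1}[w]complementK => /weight_return_complement.
  by rewrite subKn.
have nI : injective (map negb) by exact/inj_map/negb_inj.
have [|[i [j [i' [j' [r r' rr']]]]] h4] := h l (l - c).
  exists m; move: (ones_complement w m) (ones_complement w (m + l)); lia.
split.
  exists i, j, i', j'; split; [exact: back|exact: back|].
  by rewrite !block_complement => /nI.
move=> i1 j1 i2 j2 i3 j3 i4 j4 /weight_return_complement r1 /weight_return_complement r2.
move=> /weight_return_complement r3 /weight_return_complement r4.
move: (h4 _ _ _ _ _ _ _ _ r1 r2 r3 r4); rewrite !block_complement.
by rewrite -(map_inj_uniq nI).
Qed.

Lemma recurrent_complement w : recurrent w -> recurrent (complement w).
Proof.
have e u n : occurs_at (complement w) u n <-> occurs_at w (map negb u) n.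
  rewrite /occurs_at block_complement size_map; split=> [h|->].
    by rewrite -[in RHS]h -map_comp (eq_map negbK) map_id.
  by rewrite -map_comp (eq_map negbK) map_id.
move=> h u [n /e un].
rewrite (_ : [set n | _] = [set n | occurs_at w (map negb u) n]).
  by apply: h; exists n.
by apply/seteqP; split=> m /e.
Qed.

(** If the comparison were reversed between times [i] and [j], the two blocks read between these
    times would differ in weight by 2. *)
Lemma balanced_compare w n m i j : balanced w ->
  ones w (n + i) + ones w m < ones w (m + i) + ones w n ->
  ones w (n + j) + ones w m <= ones w (m + j) + ones w n.
Proof.
move=> b lt; case: (ltnP (ones w (m + j) + ones w n) (ones w (n + j) + ones w m)) => // gt.
have [ij|ji] := leqP i j.
  have := b (j - i) (n + i) (m + i).
  by rewrite -!addnA subnKC //; lia.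
have := b (i - j) (m + j) (n + j).
by rewrite -!addnA subnKC //; lia.
Qed.

(* For the least possible [l] the blocks at [n] and [m] are [0x0] and [1x1] for the
   same palindrome [x]. *)
Definition unbalanced_at w l n m :=
  ones w (m + l) + ones w n = ones w (n + l) + ones w m + 2.

Lemma minimal_unbalanced w : ~ balanced w -> exists N,
  (exists n m, unbalanced_at w N n m) /\
  (forall l n m, l < N -> ones w (n + l) + ones w m <= ones w (m + l) + ones w n + 1).
Proof.
move=> nb.
pose bad N := `[< exists n m, ones w (m + N) + ones w n + 1 < ones w (n + N) + ones w m >].
have ex : exists N, bad N.
  apply: contrapT => no; apply: nb => l n m; rewrite leqNgt; apply/negP => lt.
  by apply: no; exists l; apply/asboolP; exists n, m.
case: (ex_minnP ex) => N /asboolP[m [n lt]] Nmin.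
have small l n' m' : l < N ->
    ones w (n' + l) + ones w m' <= ones w (m' + l) + ones w n' + 1.
  move=> lN; rewrite leqNgt; apply/negP => gt.
  have : bad l by apply/asboolP; exists n', m'.
  by move=> /Nmin; lia.
exists N; split=> //; exists n, m; rewrite /unbalanced_at.
case: N => [|N] in lt small Nmin *; first by rewrite !addn0 in lt *; lia.
have := small N m n (ltnSn N).
move: lt; rewrite !addnS !onesS; case: (w (n + N)); case: (w (m + N)) => /=; lia.
Qed.

(** * The shape of a minimal unbalanced pair of blocks *)

Section Minimal.
Variables (w : infinite_word bool) (N : nat).
Hypothesis Nmin : forall l n m, l < N ->
  ones w (n + l) + ones w m <= ones w (m + l) + ones w n + 1.

(** By minimality the prefixes and the remaining suffixes each differ by at most 1, while together
    they differ by 2. *)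
Lemma unbalanced_prefix n m l : unbalanced_at w N n m -> 0 < l < N ->
  ones w (m + l) + ones w n = ones w (n + l) + ones w m + 1.
Proof.
rewrite /unbalanced_at => u /andP[l0 lN].
have := Nmin m n lN; have := @Nmin (N - l) (m + l) (n + l).
by rewrite -!addnA subnKC ?(ltnW lN) //; lia.
Qed.

Lemma unbalanced_size n m : unbalanced_at w N n m -> 2 <= N.
Proof.
case: N => [|[|M]] //; rewrite /unbalanced_at ?addn0 ?addn1 ?onesS; first by lia.
case: (w n); case: (w m) => /=; lia.
Qed.

Lemma unbalanced_ends n m : unbalanced_at w N n m ->
  [/\ w n = false, w m = true, w (n + N.-1) = false & w (m + N.-1) = true].
Proof.
move=> u; have N2 := unbalanced_size u.
have := unbalanced_prefix (l := 1) u; have := unbalanced_prefix (l := N.-1) u.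
rewrite !addn1 !onesS; move: u; rewrite /unbalanced_at.
have -> : N = N.-1.+1 by lia.
rewrite /= !addnS !onesS.
case: (w n); case: (w m); case: (w (n + N.-1)); case: (w (m + N.-1)) => /=; split=> //; lia.
Qed.

Lemma unbalanced_inner n m x : unbalanced_at w N n m -> 0 < x < N.-1 ->
  w (n + x) = w (m + x).
Proof.
move=> u x0; have := unbalanced_prefix (l := x) u; have := unbalanced_prefix (l := x.+1) u.
by rewrite !addnS !onesS; case: (w (n + x)); case: (w (m + x)) => //=; lia.
Qed.

Lemma unbalanced_palindrome n m x : unbalanced_at w N n m -> 0 < x < N.-1 ->
  w (n + (N.-1 - x)) = w (n + x).
Proof.
move=> u x0.
(* The prefix and the suffix of length [l] of the block at [n] have the same weight: those of the
   block at [m] are each heavier by 1, and a prefix of one block and a suffix of the other differ by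
   at most 1. *)
have key l : 0 < l < N ->
    ones w (n + l) + ones w (n + (N - l)) = ones w (n + N) + ones w n.
  move=> l0; have lN : l < N by lia.
  have := unbalanced_prefix u l0; have := @unbalanced_prefix n m (N - l) u.
  have := Nmin (n + (N - l)) m lN; have := Nmin m (n + (N - l)) lN.
  have := Nmin (m + (N - l)) n lN; have := Nmin n (m + (N - l)) lN.
  rewrite -!addnA !subnK ?(ltnW lN) //; move: u; rewrite /unbalanced_at; lia.
have := key x; have := key x.+1; rewrite !addnS onesS.
have -> : N - x = (N.-1 - x).+1 by lia.
have -> : N - x.+1 = N.-1 - x by lia.
rewrite addnS onesS.
by case: (w (n + x)); case: (w (n + (N.-1 - x))) => //=; lia.
Qed.

End Minimal.

End Balance.

(** * Sturmian words are balanced *)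

Section SturmianBalanced.
Implicit Types (w : infinite_word bool) (i j k l c m n p q : nat).

Lemma right_special_unique w p n m n' m' : sturmian w ->
  right_special w p n m -> right_special w p n' m' -> block w n p = block w n' p.
Proof. by move=> /sturmianP/(_ p)[_ un] r r'; apply/eq_blockP; exact: (un _ _ _ _ r r'). Qed.

Lemma right_special_complement w p n m :
  right_special w p n m -> right_special (complement w) p m n.
Proof.
case=> e wn wm; split; rewrite /complement ?wn ?wm // => x xp.
by rewrite e.
Qed.

Lemma sturmian_complement w : sturmian w -> sturmian (complement w).
Proof.
move=> /sturmianP st; apply/sturmianP => p; have [[n [m r]] un] := st p; split.
  by exists m, n; exact: right_special_complement.
move=> n1 m1 n2 m2 /right_special_complement r1 /right_special_complement r2 x xp.
rewrite !complementK in r1 r2; have [e1 _ _] := r1; have [e2 _ _] := r2.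
by rewrite /complement -e1 // -e2 // (un _ _ _ _ r1 r2).
Qed.

(** The last [N.-2] letters of the right special factor form a right special factor, as does the
    inner word x. So the factor at [n'] is 0x, and the word after [m] is shown to avoid it
    forever. *)
Lemma sturmian_no_unbalanced w N n m n' m' : recurrent w -> sturmian w ->
  (forall l n m, l < N -> ones w (n + l) + ones w m <= ones w (m + l) + ones w n + 1) ->
  unbalanced_at w N n m -> right_special w N.-1 n' m' -> w n' = false -> False.
Proof.
move=> rw st Nmin u rs' wn'.
have N2 := unbalanced_size u.
have [wn wm wnN wmN] := unbalanced_ends Nmin u.
have ex : forall y, y < N.-2 -> w (n'.+1 + y) = w (m.+1 + y).
  have r1 : right_special w N.-2 n.+1 m.+1.
    split=> [x xN||].
    - by rewrite !addSnnS; apply: (unbalanced_inner Nmin u); lia.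
    - by rewrite addSnnS -wnN; congr (w (n + _)); lia.
    - by rewrite addSnnS -wmN; congr (w (m + _)); lia.
  have r2 : right_special w N.-2 n'.+1 m'.+1.
    have [e a b] := rs'; split=> [x xN||].
    - by rewrite !addSnnS e //; lia.
    - by rewrite addSnnS -a; congr (w (n' + _)); lia.
    - by rewrite addSnnS -b; congr (w (m' + _)); lia.
  have /eq_blockP e := right_special_unique st r2 r1.
  by move=> y yN; rewrite e // !addSnnS (unbalanced_inner Nmin u) //; lia.
have special a b : block w a N.-1 = block w b N.-1 -> w (a + N.-1) <> w (b + N.-1) ->
    block w a N.-1 = block w n' N.-1.
  move=> /eq_blockP e; case wa: (w (a + N.-1)); case wb: (w (b + N.-1)) => // _.
    rewrite (right_special_unique st rs' (_ : right_special w N.-1 b a)).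
      by apply/eq_blockP.
    by split=> // x xN; rewrite e.
  by apply: (right_special_unique (m := b) st _ rs'); split.
(* If 0x began at index [i] of 1x1, then letter [i] of 1x1 would be 0 and letter [N.-1 - i] would be
   1, although x is a palindrome. *)
have not0x i : i <= N.-1 -> block w (m + i) N.-1 <> block w n' N.-1.
  move=> iN /eq_blockP e.
  have wmi : w (m + i) = false by rewrite -wn' -(addn0 (m + i)) -(addn0 n') e //; lia.
  have [i0|i0] : i = 0 \/ 0 < i by lia.
    by rewrite i0 addn0 wm in wmi.
  have [iN1|iN1] : i = N.-1 \/ i < N.-1 by lia.
    by rewrite iN1 wmN in wmi.
  have := unbalanced_palindrome Nmin u (x := i); rewrite i0 iN1 => /(_ isT).
  rewrite !(unbalanced_inner Nmin u) ?wmi; [|lia|lia].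
  have := ex (N.-2 - i); have := e (N.-1 - i).
  have -> : m + i + (N.-1 - i) = m + N.-1 by lia.
  have -> : n'.+1 + (N.-2 - i) = n' + (N.-1 - i) by lia.
  have -> : m.+1 + (N.-2 - i) = m + (N.-1 - i) by lia.
  by rewrite wmN => <-; [move=> <- //; lia|lia].
have [i [j [/andP[ij jN] eij]]] : exists i j, i < j <= N.-1 /\
    block w (m + i) N.-1 = block w (m + j) N.-1.
  apply: right_special_pigeonhole => // i n1 m1 iN r1 e1.
  by apply: (not0x i iN); rewrite -e1; exact: right_special_unique r1 rs'.
(* A block that is not right special determines the next letter, so the coincidence propagates. The
   windows of the first period avoid 0x by [not0x], the later ones repeat them. *)
have per y : block w (m + i + y) N.-1 = block w (m + j + y) N.-1 /\
    block w (m + i + y) N.-1 <> block w n' N.-1.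
  elim/ltn_ind: y => y IH; split; last first.
    have [yj|yj] := ltnP y (j - i).
      by rewrite -addnA; apply: not0x; lia.
    have [] := IH (y - (j - i)); first by lia.
    have -> : m + j + (y - (j - i)) = m + i + y by lia.
    by move=> <-.
  case: y IH => [|y] IH; first by rewrite !addn0.
  have [e ne] := IH y (ltnSn y).
  have ew : w (m + i + y + N.-1) = w (m + j + y + N.-1).
    by apply: contrapT => d; apply: ne; exact: special e d.
  apply/eq_blockP => x xN; rewrite !addnS !addSnnS.
  have [xN'|] := ltnP x.+1 N.-1; first by move/eq_blockP: e; apply.
  by move=> ?; have -> : x.+1 = N.-1 by lia.
have [q mq eq] := recurrentP rw n' N.-1 (m + i).
have [_] := per (q - (m + i)); rewrite subnKC //; apply; exact/eq_blockP.
Qed.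

Lemma sturmian_balanced w : recurrent w -> sturmian w -> balanced w.
Proof.
move=> rw st; apply: contrapT => nb.
have [N [[n [m u]] Nmin]] := minimal_unbalanced nb.
have [[n' [m' r]] _] := (sturmianP w).1 st N.-1.
(* If the right special factor is 1x, exchanging the letters turns it into the case of 0x and swaps
   the two unbalanced blocks. *)
case wn': (w n'); last exact: (sturmian_no_unbalanced rw st Nmin u r).
have N2 := unbalanced_size u.
apply: (@sturmian_no_unbalanced (complement w) N m n m' n').
- exact: recurrent_complement.
- exact: sturmian_complement.
- move=> l a b lN; move: (Nmin l b a lN) (ones_complement w a) (ones_complement w b).
  move: (ones_complement w (a + l)) (ones_complement w (b + l)); lia.
- move: u (ones_complement w n) (ones_complement w m).
  move: (ones_complement w (n + N)) (ones_complement w (m + N)).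
  rewrite /unbalanced_at; lia.
- exact: right_special_complement.
- have [e _ _] := r; rewrite /complement -[m']addn0 -e ?addn0 ?wn' //; lia.
Qed.

End SturmianBalanced.

(** * Sturmian words have two or three returns *)

(* The blocks at [n], [m] (resp. [n'], [m']) agree on [p] (resp. [p']) letters, and
   the blocks of length [l] that follow are lighter for [n], [n'] than for [m], [m']. *)
Lemma balanced_common_suffix w l p p' n m n' m' : balanced w -> p <= p' ->
  (forall x, x < p -> w (n + x) = w (m + x)) ->
  (forall x, x < p' -> w (n' + x) = w (m' + x)) ->
  ones w (n + p + l) + ones w (m' + p') < ones w (m' + p' + l) + ones w (n + p) ->
  ones w (n' + p' + l) + ones w (m + p) < ones w (m + p + l) + ones w (n' + p') ->
  forall x, x < p -> w (n + x) = w (n' + (p' - p) + x).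
Proof.
move=> bal; elim: p n m => [//|p IH] n m pp' e e' lt lt'.
have {}IH x : x < p -> w (n.+1 + x) = w (n' + (p' - p) + x).
  apply: (IH n.+1 m.+1); [exact: ltnW| |exact: e'|by rewrite addSnnS|by rewrite addSnnS].
  by move=> y yp; rewrite !addSnnS e.
have ea' : n' + (p' - p) = (n' + (p' - p.+1)).+1 by clear -pp'; lia.
rewrite ea' in IH; set a' := n' + (p' - p.+1) in IH *; pose b' := m' + (p' - p.+1).
have eb : b'.+1 + p = m' + p' by clear -pp' b'; lia.
have ea : a'.+1 + p = n' + p' by clear -pp' a'; lia.
have wa : w n = w m by have := e 0 isT; rewrite !addn0.
have wa' : w a' = w b' by apply: e'; clear -pp'; lia.
have sab : ones w (n.+1 + p) + ones w m.+1 = ones w (m.+1 + p) + ones w n.+1.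
  by apply: (@ones_agree _ _ _ p) => // x xp; rewrite !addSnnS e.
have saa : ones w (n.+1 + p) + ones w a'.+1 = ones w (a'.+1 + p) + ones w n.+1.
  exact: (@ones_agree _ _ _ p).
have sab' : ones w (a'.+1 + p) + ones w b'.+1 = ones w (b'.+1 + p) + ones w a'.+1.
  apply: (@ones_agree _ _ _ p) => // x xp.
  have -> : a'.+1 + x = n' + (p' - p + x) by clear -xp pp' a'; lia.
  have -> : b'.+1 + x = m' + (p' - p + x) by clear -xp pp' b'; lia.
  by apply: e'; clear -xp pp'; lia.
(* With v the common suffix, two different letters before it would yield a block 0v followed by a
   light block and a block 1v followed by a heavy one. The two instances of balance cover the two
   ways of differing. *)
have : w n = w a'.
  have e2 z : z + (p.+1 + l) = z.+1 + p + l by clear; lia.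
  move: (bal (p.+1 + l) b' n) (bal (p.+1 + l) m a'); rewrite !e2.
  move: sab saa sab' lt lt'; rewrite -ea -eb -!addSnnS !onesS -wa -wa'.
  clear; by case: (w n); case: (w a') => //=; lia.
by move=> wna [|x] xp; [rewrite !addn0|rewrite -!addSnnS IH].
Qed.

(** * Returns to the lightest blocks of a balanced word *)

Section LightReturns.
Variables (w : infinite_word bool) (l c : nat).
Hypothesis bal : balanced w.
Hypothesis light : forall n, ones w n + c <= ones w (n + l).

Let L n := ones w (n + l) = ones w n + c.

Lemma light_down n m i : ones w (n + i) + ones w m < ones w (m + i) + ones w n ->
  L m -> L n.
Proof.
by move=> /(balanced_compare l bal); rewrite /L; move: (light n); lia.
Qed.

(** Two light positions that have not returned yet when their letters differ for the first time. *)
Definition letter_split p n m :=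
  [/\ L n, L m, right_special w p n m & forall i, 0 < i <= p -> ~ L (n + i) /\ ~ L (m + i)].

(** The common word is a return from [n], but read from [m] it leads to a block that is not
    light. *)
Definition return_split p n m :=
  [/\ L n, L m & forall i, 0 < i < p -> ~ L (n + i) /\ ~ L (m + i)] /\
  [/\ 0 < p, forall x, x < p -> w (n + x) = w (m + x), L (n + p) & ~ L (m + p)].

(** By [balanced_common_suffix] the word of length [p] is a suffix of the one of length [p']. Were
    it a proper suffix, its start [n' + (p' - p)] would read the same letters as [m] and then 0
    against 1, hence be light, too early for a return. *)
Lemma letter_split_le p n m p' n' m' : p <= p' ->
  letter_split p n m -> letter_split p' n' m' ->
  p = p' /\ forall x, x < p -> w (n + x) = w (n' + x).
Proof.
move=> pp' [Ln Lm [e wn wm] no] [Ln' Lm' [e' wn' wm'] no'].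
have suf : forall x, x < p -> w (n + x) = w (n' + (p' - p) + x).
  apply: (@balanced_common_suffix w 1 p p' n m n' m') => //.
    by rewrite !addn1 !onesS wn wm' addn0 addn1 addnC addSn.
  by rewrite !addn1 !onesS wn' wm addn0 addn1 addnC addSn.
have [pp|pp] : p = p' \/ p < p' by lia.
  by split=> // x xp; rewrite suf // -pp subnn addn0.
exfalso; have [|nL _] := no' (p' - p); first by lia.
apply: nL; apply: (@light_down _ m p.+1) => //.
have ea x : x < p -> w (n' + (p' - p) + x) = w (m + x).
  by move=> xp; rewrite -e // -suf.
rewrite !addnS !onesS wm.
have -> : w (n' + (p' - p) + p) = false by rewrite -wn'; congr w; lia.
by have := ones_agree ea (leqnn p); lia.
Qed.

(** The comparison is that of [letter_split_le], with the blocks of length [l] after the common word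
    in the role of the next letters. *)
Lemma return_split_le p n m p' n' m' : p <= p' ->
  return_split p n m -> return_split p' n' m' ->
  p = p' /\ forall x, x < p -> w (n + x) = w (n' + x).
Proof.
move=> pp' [[Ln Lm no] [p0 e Lnp Lmp]] [[Ln' Lm' no'] [p0' e' Lnp' Lmp']].
have suf : forall x, x < p -> w (n + x) = w (n' + (p' - p) + x).
  apply: (@balanced_common_suffix w l p p' n m n' m') => //.
    by move: (light (m' + p')) Lnp Lmp'; rewrite /L; clear; lia.
  by move: (light (m + p)) Lnp' Lmp; rewrite /L; clear; lia.
have [pp|pp] : p = p' \/ p < p' by lia.
  by split=> // x xp; rewrite suf // -pp subnn addn0.
exfalso; have [|nL _] := no' (p' - p); first by lia.
have ea x : x < p -> w (n' + (p' - p) + x) = w (m + x).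
  by move=> xp; rewrite -e // -suf.
have := @balanced_compare w m (n' + (p' - p)) l (p + l) bal.
have := ones_agree ea (leqnn p).
have e1 : n' + (p' - p) + p = n' + p' by lia.
move: (light (n' + (p' - p))) (light (m + p)) nL Lm Lnp' Lmp.
by rewrite /L !addnA e1; lia.
Qed.

Lemma weight_return_diverge i j i' j' :
  weight_return w l c i j -> weight_return w l c i' j' ->
  block w i (j - i) <> block w i' (j' - i') ->
  [\/ exists p, letter_split p i i' \/ letter_split p i' i,
      return_split (j - i) i i' | return_split (j' - i') i' i].
Proof.
move=> [ij Li Lj no] [ij' Li' Lj' no'] d.
have no1 y : 0 < y < j - i -> ~ L (i + y) by move=> h; apply: no; lia.
have no1' y : 0 < y < j' - i' -> ~ L (i' + y) by move=> h; apply: no'; lia.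
have Lij : L (i + (j - i)) by rewrite subnKC // ltnW.
have Lij' : L (i' + (j' - i')) by rewrite subnKC // ltnW.
case: (pselect (exists x, (x < minn (j - i) (j' - i')) && (w (i + x) != w (i' + x)))).
  move=> ex; case: (ex_minnP ex) => p /andP[px wp] pmin.
  have e x : x < p -> w (i + x) = w (i' + x).
    move=> xp; apply/eqP/negPn/negP => h.
    by have := pmin x; rewrite h andbT; lia.
  apply: Or31; exists p; case wi: (w (i + p)) wp; case wi': (w (i' + p)) => // _.
    right; split=> //; first by split=> // x xp; rewrite e.
    by move=> y yp; split; [apply: no1'|apply: no1]; lia.
  left; split=> //; move=> y yp; split; [apply: no1|apply: no1']; lia.
move=> nex; have e x : x < minn (j - i) (j' - i') -> w (i + x) = w (i' + x).
  move=> xm; apply/eqP/negPn/negP => h; apply: nex; exists x; by rewrite xm h.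
case: (ltngtP (j - i) (j' - i')) => h.
- apply: Or32; split; split=> //; [|lia| |apply: no1'; lia].
    by move=> y yp; split; [apply: no1|apply: no1']; lia.
  by move=> x xp; apply: e; lia.
- apply: Or33; split; split=> //; [|lia| |apply: no1; lia].
    by move=> y yp; split; [apply: no1'|apply: no1]; lia.
  by move=> x xp; rewrite e //; lia.
- by case: d; rewrite h; apply/eq_blockP => x xp; apply: e; rewrite h minnn.
Qed.

Definition split_return v := exists p n m, return_split p n m /\ v = block w n p.

Lemma split_return_unique v v' : split_return v -> split_return v' -> v = v'.
Proof.
move=> [p [n [m [r ->]]]] [p' [n' [m' [r' ->]]]].
by case/orP: (leq_total p p') => pp;
  [have [<- e] := return_split_le pp r r'|have [<- e] := return_split_le pp r' r];
  apply/eq_blockP => x /e.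
Qed.

Lemma letter_split_unique p n m p' n' m' :
  letter_split p n m -> letter_split p' n' m' -> p = p'.
Proof.
move=> s s'; case/orP: (leq_total p p') => pp.
  by have [] := letter_split_le pp s s'.
by have [] := letter_split_le pp s' s.
Qed.

(** At most one of the four is a [split_return]. Three others would diverge pairwise by letters,
    always at the same index [p], where only two letters are available. *)
Lemma at_most_three_light i1 j1 i2 j2 i3 j3 i4 j4 :
  weight_return w l c i1 j1 -> weight_return w l c i2 j2 ->
  weight_return w l c i3 j3 -> weight_return w l c i4 j4 ->
  ~ uniq [:: block w i1 (j1 - i1); block w i2 (j2 - i2);
             block w i3 (j3 - i3); block w i4 (j4 - i4)].
Proof.
have letter i j i' j' : weight_return w l c i j -> weight_return w l c i' j' ->
    ~ split_return (block w i (j - i)) -> ~ split_return (block w i' (j' - i')) ->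
    block w i (j - i) != block w i' (j' - i') ->
    exists p n m, letter_split p n m /\ w (i + p) != w (i' + p).
  move=> r r' s s' /eqP d; case: (weight_return_diverge r r' d).
  - case=> p [] sp; [exists p, i, i'|exists p, i', i]; split=> //;
      by have [_ _ [_ -> ->] _] := sp.
  - by move=> sp; case: s; exists (j - i), i, i'.
  - by move=> sp; case: s'; exists (j' - i'), i', i.
have three i j i' j' i'' j'' : weight_return w l c i j -> weight_return w l c i' j' ->
    weight_return w l c i'' j'' ->
    ~ split_return (block w i (j - i)) -> ~ split_return (block w i' (j' - i')) ->
    ~ split_return (block w i'' (j'' - i'')) ->
    ~ uniq [:: block w i (j - i); block w i' (j' - i'); block w i'' (j'' - i'')].
  move=> r r' r'' s s' s''; rewrite /= !inE negb_or andbT => /andP[/andP[d1 d2] d3].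
  have [p1 [n1 [m1 [sp1 e1]]]] := letter _ _ _ _ r r' s s' d1.
  have [p2 [n2 [m2 [sp2 e2]]]] := letter _ _ _ _ r r'' s s'' d2.
  have [p3 [n3 [m3 [sp3 e3]]]] := letter _ _ _ _ r' r'' s' s'' d3.
  move: e2 e3; rewrite (letter_split_unique sp2 sp1) (letter_split_unique sp3 sp1).
  by move: e1; case: (w (i + p1)); case: (w (i' + p1)); case: (w (i'' + p1)).
move=> r1 r2 r3 r4 u.
have cas v v' : v != v' -> ~ split_return v \/ ~ split_return v'.
  move=> vv; case: (pselect (split_return v)) => sv; [right|by left].
  by move=> sv'; move/eqP: vv; apply; exact: split_return_unique.
have := u; rewrite /= !inE !negb_or !andbT => /andP[/and3P[d12 d13 d14] /andP[/andP[d23 d24] d34]].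
case: (pselect (split_return (block w i1 (j1 - i1)))) => s1.
  apply: (three _ _ _ _ _ _ r2 r3 r4); [..|by case/andP: u].
  - by case: (cas _ _ d12).
  - by case: (cas _ _ d13).
  - by case: (cas _ _ d14).
case: (pselect (split_return (block w i2 (j2 - i2)))) => s2.
  apply: (three _ _ _ _ _ _ r1 r3 r4) => //.
  - by case: (cas _ _ d23).
  - by case: (cas _ _ d24).
  - by rewrite /= !inE negb_or d13 d14 d34.
case: (cas _ _ d34) => s.
  by apply: (three _ _ _ _ _ _ r1 r2 r3) => //; rewrite /= !inE negb_or d12 d13 d23.
by apply: (three _ _ _ _ _ _ r1 r2 r4) => //; rewrite /= !inE negb_or d12 d14 d24.
Qed.

End LightReturns.

(** With a single return, of length [q], the word has period [q] from [m] on. Then every letter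
    equals the one [q] places before it, so no factor of length [q] that recurs there is right
    special. *)
Lemma sturmian_two_returns w l c m : recurrent w -> sturmian w ->
  ones w (m + l) = ones w m + c ->
  exists i j i' j', [/\ weight_return w l c i j, weight_return w l c i' j' &
                        block w i (j - i) <> block w i' (j' - i')].
Proof.
move=> rw /sturmianP st cm; apply: contrapT => no.
have next i : ones w (i + l) = ones w i + c -> exists j, weight_return w l c i j.
  move=> ci; have [k ik ek] := recurrentP rw i l i.+1.
  have [|j r _] := @weight_return_exists w l c i k ik ci; last by exists j.
  by have := ones_agree ek (leqnn l); lia.
have [j rmj] := next m cm; have [mj _ _ _] := rmj; set q := j - m.
have ret i : ones w (i + l) = ones w i + c ->
    ones w (i + q + l) = ones w (i + q) + c /\ forall x, x < q -> w (i + x) = w (m + x).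
  move=> ci; have [k rik] := next i ci; have [ik _ ck _] := rik.
  have /eq_block[qk e] : block w m q = block w i (k - i).
    by apply: contrapT => d; apply: no; exists m, j, i, k.
  have <- : k = i + q by rewrite qk; lia.
  by split=> // x xq; rewrite e.
have cls t : ones w (m + t * q + l) = ones w (m + t * q) + c.
  elim: t => [|t IH]; first by rewrite addn0.
  by rewrite mulSnr addnA; have [] := ret _ IH.
have q0 : 0 < q by rewrite /q; lia.
have per x : w (m + x) = w (m + x %% q).
  rewrite {1}(divn_eq x q) addnA.
  by have [_ ->] := ret _ (cls (x %/ q)); rewrite // ltn_mod.
have per' n : m <= n -> w (n + q) = w n.
  by move=> mn; rewrite -(subnKC mn) -addnA per modnDr -per.
have [[n [n' [e wn wn']]] _] := st q.
have [a ma ea] := recurrentP rw n q.+1 m.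
have [a' ma' ea'] := recurrentP rw n' q.+1 m.
have : w (a + q) = w (a' + q).
  by rewrite !per' // -[a]addn0 -[a']addn0 ea // ea' // e.
by rewrite ea // ea' // wn wn'.
Qed.

Lemma sturmian_two_or_three w : recurrent w -> sturmian w -> two_or_three_returns w.
Proof.
move=> rw st l c [m cm]; split; first exact: sturmian_two_returns cm.
have bal := sturmian_balanced rw st.
(* By balance [c] is the least or the greatest weight at length [l]; the greatest becomes the least
   after exchanging the letters. *)
case: (pselect (forall n, ones w n + c <= ones w (n + l))) => [lt|nlt].
  exact: at_most_three_light.
have heavy n : ones w (n + l) <= ones w n + c.
  rewrite leqNgt; apply/negP => h; apply: nlt => n'.
  by have := bal l n n'; lia.
move=> i1 j1 i2 j2 i3 j3 i4 j4.
rewrite -[w]complementK => /weight_return_complement r1 /weight_return_complement r2.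
move=> /weight_return_complement r3 /weight_return_complement r4.
rewrite !(block_complement (complement w)).
have nI : injective (map negb) by exact/inj_map/negb_inj.
rewrite (map_inj_uniq nI [:: _; _; _; _]).
apply: at_most_three_light r1 r2 r3 r4; first exact: balanced_complement.
move=> n; move: (ones_complement w n) (ones_complement w (n + l)) (heavy n).
by have := @ones_mono (complement w) n (n + l); lia.
Qed.

(** * Balanced words with two or three returns are Sturmian *)

Lemma total_least (R : nat -> nat -> Prop) k :
  (forall n m, R n m \/ R m n) -> (forall n m p, R n m -> R m p -> R n p) ->
  exists n, n <= k /\ forall m, m <= k -> R n m.
Proof.
move=> tot trans; have refl n : R n n by case: (tot n n).
elim: k => [|k [n [nk nmin]]]; first by exists 0; split=> // -[].
case: (tot n k.+1) => h.
  exists n; split; first by lia.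
  move=> m; rewrite leq_eqVlt => /orP[/eqP -> //|]; exact: nmin.
exists k.+1; split=> // m; rewrite leq_eqVlt => /orP[/eqP -> //|mk].
by apply: trans h _; exact: nmin.
Qed.

Lemma balanced_right_special w p : recurrent w -> balanced w ->
  two_or_three_returns w -> exists n m, right_special w p n m.
Proof.
move=> rw bal good; apply: contrapT => no.
have det n m : (forall x, x < p -> w (n + x) = w (m + x)) -> w (n + p) = w (m + p).
  move=> e; case wn: (w (n + p)); case wm: (w (m + p)) => //; case: no.
    by exists m, n; split=> // x xp; rewrite e.
  by exists n, m.
(* Each factor of length [p] determines the next letter, so a second occurrence of the prefix makes
   [q] a period of the whole word. *)
have [q q0 eq] := recurrentP rw 0 p 1.
have agree d : forall x, x < p -> w (q + d + x) = w (d + x).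
  elim: d => [|d IH] x xp; first by rewrite addn0 eq.
  rewrite addnS !addSnnS; have [|px] := ltnP x.+1 p; first exact: IH.
  have -> : x.+1 = p by lia.
  exact: det IH.
have per y : w (q + y) = w y.
  have [yp|py] := ltnP y p; first exact: eq.
  by rewrite -(subnK py) addnA; apply: det => x; exact: agree.
have onesq n : ones w (n + q) = ones w n + ones w q.
  elim: n => [|n IH]; first by rewrite add0n /ones big_ord0.
  by rewrite addSn !onesS IH addnC [in LHS](addnC n) per; lia.
have onesqs n t : ones w (n + t * q) = ones w n + t * ones w q.
  elim: t => [|t IH]; first by rewrite !mul0n !addn0.
  by rewrite mulSnr addnA onesq IH; lia.
pose le n m := forall j, ones w (n + j) + ones w m <= ones w (m + j) + ones w n.
have tot n m : le n m \/ le m n.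
  case: (pselect (le n m)) => h; [by left|right => j].
  have [i gt] : exists i, ones w (m + i) + ones w n < ones w (n + i) + ones w m.
    apply: contrapT => h'; apply: h => i; rewrite leqNgt; apply/negP => gt.
    by apply: h'; exists i.
  exact: balanced_compare gt.
have trans n m k : le n m -> le m k -> le n k.
  by move=> h h' j; move: (h j) (h' j); lia.
have mod n j : ones w (n %% q + j) + ones w n = ones w (n + j) + ones w (n %% q).
  move: (onesqs (n %% q + j) (n %/ q)) (onesqs (n %% q) (n %/ q)).
  have -> : n %% q + j + n %/ q * q = n + j by rewrite {3}(divn_eq n q); lia.
  have -> : n %% q + n %/ q * q = n by rewrite {3}(divn_eq n q); lia.
  by lia.
have [n0 [n0q n0min]] := total_least q tot trans.
have {}n0min n : le n0 n.
  move=> j; have := n0min (n %% q) _ j; have := mod n j.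
  have : n %% q <= q by rewrite ltnW // ltn_mod.
  by move=> -> ; move: (n %% q) => r e /(_ isT); lia.
have [n1 [n1q n1max]] := total_least q (fun n m => tot m n)
  (fun n m k h h' => trans _ _ _ h' h).
have {}n1max n : le n n1.
  move=> j; have := n1max (n %% q) _ j; have := mod n j.
  have : n %% q <= q by rewrite ltnW // ltn_mod.
  by move=> -> ; move: (n %% q) => r e /(_ isT); lia.
(* The period is added so that the subtraction does not truncate; it leaves the suffix at [n1]
   unchanged. *)
pose l := n1 + q - n0; have n0l : n0 + l = n1 + q by rewrite /l; lia.
pose c := ones w (n0 + l) - ones w n0.
have cn0 : ones w (n0 + l) = ones w n0 + c.
  by have := @ones_mono w n0 (n0 + l); rewrite /c; lia.
(* From [n] the sums are at least those from [n0]. From [n + l] they are at most those from [n1],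
   hence from [n0 + l]. Equal weight at length [l] therefore forces equality at all greater
   lengths. *)
have same n : ones w (n + l) = ones w n + c ->
    forall j, ones w (n + j) + ones w n0 = ones w (n0 + j) + ones w n.
  move=> cn; have big j : ones w (n + (l + j)) + ones w n0 = ones w (n0 + (l + j)) + ones w n.
    have := n0min n (l + j); have := n1max (n + l) j.
    rewrite !addnA n0l; have := onesq (n1 + j); have := onesq n1; rewrite -n0l.
    have -> : n1 + j + q = n0 + l + j by lia.
    by lia.
  (* The padding makes the total length [j + l * q], which differs from [j] by a multiple of the
     period. *)
  move=> j; have := big (j + l * q.-1).
  have e z : z + (l + (j + l * q.-1)) = z + j + l * q by rewrite -{2}(prednK q0) mulnS; lia.
  by rewrite !e !onesqs; lia.
have [|[i [j [i' [j' [[ij ci cj no1] [ij' ci' cj' no2] d]]]]] _] := good l c.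
  by exists n0.
apply: d.
have ii x : ones w (i + x) + ones w i' = ones w (i' + x) + ones w i.
  by have := same _ ci x; have := same _ ci' x; lia.
have wii x : w (i + x) = w (i' + x).
  have := ii x; have := ii x.+1; rewrite !addnS !onesS.
  by case: (w (i + x)); case: (w (i' + x)) => //=; lia.
have cls x : ones w (i + x + l) = ones w (i + x) + c <->
    ones w (i' + x + l) = ones w (i' + x) + c.
  by have := ii x; have := ii (x + l); rewrite !addnA; lia.
have -> : j - i = j' - i'.
  case: (ltngtP (j - i) (j' - i')) => // h; exfalso.
    apply: (no2 (i' + (j - i))); first by lia.
    by apply/cls; rewrite subnKC // ltnW.
  apply: (no1 (i + (j' - i'))); first by lia.
  by apply/cls; rewrite subnKC // ltnW.
by apply/eq_blockP => x _.
Qed.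

Lemma balanced_sturmian w : recurrent w -> balanced w ->
  two_or_three_returns w -> sturmian w.
Proof.
move=> rw bal good; apply/sturmianP => p; split; first exact: balanced_right_special.
move=> n m n' m' [e wn wm] [e' wn' wm'] x xp.
rewrite (@balanced_common_suffix w 1 p p n m n' m') ?subnn ?addn0 //.
- by rewrite !addn1 !onesS wn wm' addn0 addn1 addnC addSn.
- by rewrite !addn1 !onesS wn' wm addn0 addn1 addnC addSn.
Qed.

(** * Minimal unbalanced blocks *)

Lemma zero_chain w (X : nat -> Prop) p0 : X p0 ->
  (forall p, X p -> exists g, [/\ 0 < g, w (p + g) = false,
      forall x, 0 < x < g -> w (p + x) = true & X (p + g)]) ->
  forall q, p0 <= q -> w q = false -> X q.
Proof.
move=> X0 step q p0q wq.
have : forall k p, p <= q -> q - p <= k -> X p -> X q.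
  elim=> [|k IH] p pq pk Xp; first by have -> : q = p by lia.
  have [->//|pq'] : q = p \/ p < q by lia.
  have [g [g0 wg g1 Xg]] := step p Xp.
  have gq : p + g <= q.
    rewrite leqNgt; apply/negP => h; have := g1 (q - p).
    rewrite subnKC // wq; have -> : 0 < q - p < g by lia.
    by move/(_ isT).
  by apply: IH Xg => //; lia.
by move=> /(_ (q - p0) p0 p0q (leqnn _) X0).
Qed.

(** * Inner words containing both letters *)

Section Nonconstant.
Variables (w : infinite_word bool) (N c n0 m0 : nat).
Hypothesis rw : recurrent w.
Hypothesis Nmin : forall l n m, l < N ->
  ones w (n + l) + ones w m <= ones w (m + l) + ones w n + 1.
Hypothesis un : unbalanced_at w N n0 m0.
Hypothesis lown0 : ones w (n0 + N) + 1 = ones w n0 + c.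
Hypothesis inner0 : exists x, 0 < x < N.-1 /\ w (m0 + x) = false.
Hypothesis inner1 : exists x, 0 < x < N.-1 /\ w (m0 + x) = true.

(** The weights [c - 1] of 0x0 and [c + 1] of 1x1; the class to be studied is the one in between. *)
Let low p := ones w (p + N) + 1 = ones w p + c.
Let high p := ones w (p + N) = ones w p + c.+1.

Lemma high_m0 : high m0.
Proof. by move: un lown0; rewrite /unbalanced_at /high; lia. Qed.

(** Blocks of length [N.-1] differ by at most 1 and one letter adds at most 1, so weights at length
    [N] differ by at most 2. *)
Lemma weight_range p : ones w p + c <= ones w (p + N) + 1 /\
  ones w (p + N) <= ones w p + c.+1.
Proof.
have N2 := unbalanced_size un.
have close q r : ones w (q + N) + ones w r <= ones w (r + N) + ones w q + 2.
  have := @Nmin N.-1 q r; have e z : ones w (z + N) = ones w (z + N.-1) + w (z + N.-1).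
    by rewrite -onesS; congr ones; lia.
  by rewrite !e; case: (w (q + _)); case: (w (r + _)) => /=; lia.
move: (close p n0) (close m0 p) high_m0 lown0; rewrite /high; lia.
Qed.

Lemma low_high p q : low p -> high q -> unbalanced_at w N p q.
Proof. by rewrite /low /high /unbalanced_at; lia. Qed.

Lemma lowP p : low p ->
  [/\ w p = false, w (p + N.-1) = false & forall x, 0 < x < N.-1 -> w (p + x) = w (m0 + x)].
Proof.
move=> lp; have u := low_high lp high_m0; have [a _ b _] := unbalanced_ends Nmin u.
by split=> // x xN; exact: (unbalanced_inner Nmin u).
Qed.

Lemma highP p : high p ->
  [/\ w p = true, w (p + N.-1) = true & forall x, 0 < x < N.-1 -> w (p + x) = w (m0 + x)].
Proof.
move=> hp; have u := low_high lown0 hp; have [_ a _ b] := unbalanced_ends Nmin u.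
split=> // x xN; rewrite -(unbalanced_inner Nmin u xN).
exact: (unbalanced_inner Nmin un xN).
Qed.

(** When bxb occurs at two consecutive positions, the word bx equals its own shift, so all its
    letters are b. *)
Lemma inner_constant p b : w p = b -> w p.+1 = b ->
  w (p + N.-1) = b -> w (p.+1 + N.-1) = b ->
  (forall x, 0 < x < N.-1 -> w (p + x) = w (m0 + x)) ->
  (forall x, 0 < x < N.-1 -> w (p.+1 + x) = w (m0 + x)) ->
  forall x, 0 < x < N.-1 -> w (m0 + x) = b.
Proof.
move=> w0 w1 wN wN1 e e1; suff all x : x <= N.-1 -> w (p + x) = b.
  by move=> x xN; rewrite -e // all //; lia.
elim: x => [|x IH] xN; first by rewrite addn0.
have [->|x0] : x = 0 \/ 0 < x by lia.
  by rewrite addn1.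
by rewrite -addSnnS e1 -?e ?IH //; lia.
Qed.

Lemma slideS p : ones w (p.+1 + N) = ones w (p + N) + w (p + N).
Proof. by rewrite addSn onesS. Qed.

Lemma high_high p : high p -> ~ high p.+1.
Proof.
move=> /highP[a b e] /highP[a' b' e'].
have [x [xN]] := inner0.
by rewrite (inner_constant a a' b b' e e').
Qed.

Lemma low_low p : low p -> ~ low p.+1.
Proof.
move=> /lowP[a b e] /lowP[a' b' e'].
have [x [xN]] := inner1.
by rewrite (inner_constant a a' b b' e e').
Qed.

Lemma high_next p : high p -> ones w (p.+1 + N) = ones w p.+1 + c.
Proof.
move=> hp; have := high_high hp; have [wp _ _] := highP hp.
by move: hp; rewrite /high slideS onesS wp; case: (w (p + N)) => /=; lia.
Qed.

Lemma low_next p : low p -> ones w (p.+1 + N) = ones w p.+1 + c.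
Proof.
move=> hp; have := low_low hp; have [wp _ _] := lowP hp.
by move: hp; rewrite /low slideS onesS wp; case: (w (p + N)) => /=; lia.
Qed.

Lemma high_prev p : high p.+1 -> ones w (p + N) = ones w p + c /\ w p = false.
Proof.
move=> hp; have nh : ~ high p by move=> /high_high.
have := (weight_range p); move: hp nh.
by rewrite /high slideS onesS; case: (w (p + N)); case: (w p) => /=; lia.
Qed.

Lemma low_prev p : low p.+1 -> ones w (p + N) = ones w p + c /\ w p = true.
Proof.
move=> hp; have nh : ~ low p by move=> /low_low.
have := (weight_range p); move: hp nh.
by rewrite /low slideS onesS; case: (w (p + N)); case: (w p) => /=; lia.
Qed.

Lemma high_recurs B : exists2 p, B <= p & high p.
Proof.
have [p Bp e] := recurrentP rw m0 N B; exists p => //.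
by have := ones_agree e (leqnn N); move: high_m0; rewrite /high; lia.
Qed.

Lemma low_recurs B : exists2 p, B <= p & low p.
Proof.
have [p Bp e] := recurrentP rw n0 N B; exists p => //.
by have := ones_agree e (leqnn N); move: lown0; rewrite /low; lia.
Qed.

(* If it failed, every 0 of [w] would begin [0x0] or [01x], and the first 0 of [x]
   shows that one of these two types can only be followed by itself. *)
Lemma zero_return : exists p, [/\ ones w (p + N) = ones w p + c,
  ones w (p.+1 + N) = ones w p.+1 + c & w p = false].
Proof.
apply: contrapT => no.
have typ p : w p = false -> low p \/ high p.+1.
  move=> wp; have [r1 r2] := weight_range p.
  have : ~ (ones w (p + N) = ones w p + c /\ ones w (p.+1 + N) = ones w p.+1 + c).
    by move=> [a b]; apply: no; exists p.
  have : ~ high p by move=> /highP[]; rewrite wp.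
  by rewrite /low /high slideS onesS wp; case: (w (p + N)) => /=; lia.
have ex : exists x, (0 < x < N.-1) && ~~ w (m0 + x).
  by have [x [xN wx]] := inner0; exists x; rewrite xN wx.
(* The index of the first 0 of x: the next 0 comes [a] letters after the start of 0x0, and [a.+1]
   letters after the start of 01x1. *)
case: (ex_minnP ex) => a /andP[aN /negPf wa] amin.
have w1 x : 0 < x < a -> w (m0 + x) = true.
  move=> xa; apply/negPn/negP => h; have := amin x; rewrite h andbT; lia.
have wma : w (m0 + (N.-1 - a)) = false.
  have := unbalanced_palindrome Nmin un aN.
  by rewrite !(unbalanced_inner Nmin un) ?wa //; lia.
have aa : a + a <= N.-1.
  rewrite leqNgt; apply/negP => h; have /w1 : 0 < N.-1 - a < a by lia.
  by rewrite wma.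
have lowa p : low p -> w (p + a) = false by move=> /lowP[_ _ ->].
have lowx p x : low p -> 0 < x < a -> w (p + x) = true.
  by move=> /lowP[_ _ e] xa; rewrite e ?w1 //; lia.
have higha p : high p.+1 -> w (p + a.+1) = false.
  by move=> /highP[_ _ e]; rewrite -addSnnS e.
have highx p x : high p.+1 -> 0 < x < a.+1 -> w (p + x) = true.
  move=> /highP[h1 _ e] xa; case: x xa => [//|[|x]] xa; first by rewrite addn1.
  by rewrite -addSnnS e ?w1 //; lia.
(* Letter [a + a] of 0x0 decides. If it is 1, a 0 beginning 01x1 cannot be followed by one beginning
   0x0; if it is 0, a 0 beginning 0x0 cannot be followed by one beginning 01x1. The surviving type
   never ends, but the other block recurs. *)
have [B|B] : (a + a < N.-1 /\ w (m0 + (a + a)) = true) \/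
             (a + a = N.-1 \/ w (m0 + (a + a)) = false).
  move: aa; rewrite leq_eqVlt => /orP[/eqP|] aa; first by right; left.
  by case: (w (m0 + (a + a))); [left|right; right].
  have [q q1 hq] := high_recurs 1; have eq : q = q.-1.+1 by lia.
  rewrite eq in hq; have [r r1 lr] := low_recurs q.-1.
  have [wr _ _] := lowP lr.
  have : high r.+1.
    apply: (@zero_chain w (fun p => high p.+1) q.-1) => // p hp.
    exists a.+1; split=> //; [exact: higha|by move=> x; exact: highx|].
    have [lpa|//] := typ _ (higha p hp).
    have := lowa _ lpa; have [_ _ e] := highP hp.
    have -> : p + a.+1 + a = p.+1 + (a + a) by lia.
    by rewrite e ?B.2 //; lia.
  by move: lr; rewrite /low /high slideS onesS wr; case: (w (r + N)) => /=; lia.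
have [q q1 hq] := high_recurs n0.+1; have eq : q = q.-1.+1 by lia.
rewrite eq in hq; have [cq wq] := high_prev hq.
have : low q.-1.
  apply: (@zero_chain w low n0) => //; [|by lia] => p lp.
  exists a; split=> //; [lia|exact: lowa|by move=> x; exact: lowx|].
  have [//|hpa] := typ _ (lowa p lp).
  have /(highx _ a hpa) : 0 < a < a.+1 by lia.
  have [_ e1 e] := lowP lp; rewrite -addnA; case: B => B.
    by rewrite B e1.
  have [B'|B'] : a + a = N.-1 \/ a + a < N.-1 by lia.
    by rewrite B' e1.
  by rewrite e ?B //; lia.
by rewrite /low; lia.
Qed.

End Nonconstant.

Implicit Types (w : infinite_word bool).

Lemma block_neq_size w n m l l' : l <> l' -> block w n l != block w m l'.
Proof. by move=> ll; apply/eqP => /eq_block[]. Qed.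

Lemma block_neq_nth w x n m l l' : x < l -> w (n + x) <> w (m + x) ->
  block w n l != block w m l'.
Proof. by move=> xl d; apply/eqP => /eq_block[_ /(_ x xl)]. Qed.

Lemma block_neq_head w n m l l' : 0 < l -> w n <> w m ->
  block w n l != block w m l'.
Proof. by move=> l0 d; apply: (@block_neq_nth _ 0); rewrite ?addn0. Qed.

Lemma weight_return_step w l c p :
  ones w (p + l) = ones w p + c -> ones w (p.+1 + l) = ones w p.+1 + c ->
  weight_return w l c p p.+1.
Proof. by move=> cp cp'; split=> // k; lia. Qed.

Lemma no_four_returns w l c i1 j1 i2 j2 i3 j3 i4 j4 : two_or_three_returns w ->
  weight_return w l c i1 j1 -> weight_return w l c i2 j2 ->
  weight_return w l c i3 j3 -> weight_return w l c i4 j4 ->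
  block w i1 (j1 - i1) != block w i2 (j2 - i2) ->
  block w i1 (j1 - i1) != block w i3 (j3 - i3) ->
  block w i1 (j1 - i1) != block w i4 (j4 - i4) ->
  block w i2 (j2 - i2) != block w i3 (j3 - i3) ->
  block w i2 (j2 - i2) != block w i4 (j4 - i4) ->
  block w i3 (j3 - i3) != block w i4 (j4 - i4) -> False.
Proof.
move=> good r1 r2 r3 r4 d12 d13 d14 d23 d24 d34.
have [_ h4] : _ /\ _ := good l c (ex_intro _ i1 (let: And4 _ h _ _ := r1 in h)).
by apply: (h4 _ _ _ _ _ _ _ _ r1 r2 r3 r4); rewrite /= !inE !negb_or d12 d13 d14 d23 d24 d34.
Qed.

(** Serves to move a return beyond the initial letters that a decomposition into runs leaves
    unconstrained. *)
Lemma weight_return_recurs w l c i j B : recurrent w -> weight_return w l c i j ->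
  exists i', [/\ B <= i', weight_return w l c i' (i' + (j - i)) &
                block w i' (j - i) = block w i (j - i)].
Proof.
move=> rw [ij ci cj no]; have [i' Bi' e] := recurrentP rw i (j - i + l) B.
have cls x : x <= j - i -> ones w (i' + x + l) = ones w (i' + x) + c <->
    ones w (i + x + l) = ones w (i + x) + c.
  move=> xj; have := ones_agree e (_ : x <= _); have := ones_agree e (_ : x + l <= _).
  by rewrite !addnA leq_add2r => /(_ xj) ? /(_ (leq_trans xj (leq_addr _ _))); lia.
exists i'; split=> //; last by apply/eq_blockP => x xj; apply: e; lia.
split; first by lia.
- by have := (cls 0 isT).2; rewrite !addn0 => ->.
- by apply/cls => //; rewrite subnKC // ltnW.
- move=> k /andP[ik kj]; rewrite -(subnKC (ltnW ik)) => /cls h.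
  by apply: (no (i + (k - i'))); [lia|apply: h; lia].
Qed.

Lemma unbalanced_constant w N n m : recurrent w -> two_or_three_returns w ->
  (forall l n m, l < N -> ones w (n + l) + ones w m <= ones w (m + l) + ones w n + 1) ->
  unbalanced_at w N n m ->
  exists b, forall x, 0 < x < N.-1 -> w (m + x) = b.
Proof.
move=> rw good Nmin un; apply: contrapT => no.
have nonconst b : exists x, 0 < x < N.-1 /\ w (m + x) = b.
  apply: contrapT => nb; apply: no; exists (~~ b) => x xN.
  by apply/eqP/negPn/negP => h; apply: nb; exists x; case: b (w (m + x)) h => -[].
have N2 := unbalanced_size un.
pose c := (ones w (n + N) - ones w n).+1.
have lown : ones w (n + N) + 1 = ones w n + c.
  by have := @ones_mono w n (n + N); rewrite /c; lia.
have cN : c <= N.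
  move: un; have := @ones_mono w m (m + N); rewrite /unbalanced_at; lia.
have [p [cp cp' wp]] := zero_return rw Nmin un lown (nonconst false).
have [q [cq cq' wq]] : exists q, [/\ ones w (q + N) = ones w q + c,
    ones w (q.+1 + N) = ones w q.+1 + c & w q = true].
  have back x : ones (complement w) (x + N) = ones (complement w) x + (N - c) ->
      ones w (x + N) = ones w x + c.
    by move: (ones_complement w x) (ones_complement w (x + N)); lia.
  have := @zero_return (complement w) N (N - c) m n (recurrent_complement rw).
  have Nmin' k a b : k < N -> ones (complement w) (a + k) + ones (complement w) b <=
      ones (complement w) (b + k) + ones (complement w) a + 1.
    move=> kN; move: (Nmin k b a kN) (ones_complement w a) (ones_complement w b).
    by move: (ones_complement w (a + k)) (ones_complement w (b + k)); lia.
  move=> /(_ Nmin'); case.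
  - move: un (ones_complement w n) (ones_complement w m).
    move: (ones_complement w (n + N)) (ones_complement w (m + N)).
    by rewrite /unbalanced_at; lia.
  - move: (ones_complement w m) (ones_complement w (m + N)) un.
    by rewrite /unbalanced_at; lia.
  - have [x [xN wx]] := nonconst true; exists x; split=> //.
    by rewrite /complement (unbalanced_inner Nmin un) ?wx.
  - by move=> q [/back cq /back cq' /negbFE wq]; exists q.
have [h h1 hh] := high_recurs rw un lown 1.
have eh : h = h.-1.+1 by lia.
have [k k1 lk] := low_recurs rw lown 1.
have ek : k = k.-1.+1 by lia.
rewrite eh in hh; rewrite ek in lk.
have [wh _ _] := highP Nmin un lown hh.
have [wk _ _] := lowP Nmin un lown lk.
have ch := high_next Nmin un lown (nonconst false) hh.
have ck := low_next Nmin un lown (nonconst true) lk.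
have [ch' wh'] := high_prev Nmin un lown (nonconst false) hh.
have [ck' wk'] := low_prev Nmin un lown (nonconst true) lk.
(* Around 1x1 the class is left for one position only, which gives the return 01; around 0x0 it
   gives 10. *)
have rh : weight_return w N c h.-1 h.-1.+2.
  split=> // x xh; have -> : x = h.-1.+1 by lia.
  by rewrite hh; lia.
have rk : weight_return w N c k.-1 k.-1.+2.
  split=> // x xk; have -> : x = k.-1.+1 by lia.
  by lia.
apply: (no_four_returns good (weight_return_step cp cp') (weight_return_step cq cq') rh rk).
- by apply: block_neq_head; rewrite ?wp ?wq //; lia.
- by apply: block_neq_size; lia.
- by apply: block_neq_size; lia.
- by apply: block_neq_size; lia.
- by apply: block_neq_size; lia.
- by apply: block_neq_head; rewrite ?wh' ?wk' //; lia.
Qed.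

Lemma next_return w l c i : recurrent w -> ones w (i + l) = ones w i + c ->
  exists j, weight_return w l c i j.
Proof.
move=> rw ci; have [k ik ek] := recurrentP rw i l i.+1.
have [|j r _] := @weight_return_exists w l c i k ik ci; last by exists j.
by have := ones_agree ek (leqnn l); lia.
Qed.

Lemma next_long_return w l c i d : recurrent w -> ones w (i + l) = ones w i + c ->
  (forall x, 0 < x < d -> ones w (i + x + l) <> ones w (i + x) + c) ->
  exists j, weight_return w l c i j /\ d <= j - i.
Proof.
move=> rw ci no; have [j r] := next_return rw ci; exists j; split=> //.
have [ij _ cj _] := r; rewrite leqNgt; apply/negP => h.
by apply: (no (j - i)); rewrite ?subnKC //; lia.
Qed.

(** * Isolated letters *)

(* [gal] says that [O k] is the position of the [K + k + 1]-st letter 1 of [w]. *)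
Section OnesPositions.
Variables (w : infinite_word bool) (O : nat -> nat) (K : nat).
Hypothesis gal : forall k n, (n <= O k) = (ones w n <= K + k).

Lemma w_O k : w (O k) = true.
Proof.
have := gal k (O k); have := gal k (O k).+1; rewrite onesS.
by case: (w (O k)) => //=; lia.
Qed.

Lemma w_gap k n : O k < n < O k.+1 -> w n = false.
Proof.
move=> kn; have := gal k n; have := gal k.+1 n.+1; rewrite onesS.
by case: (w n) => //=; lia.
Qed.

(** The bounds on [n] say that the first 1 at or after [n] is at [O k.+1]; those on [n + l] say the
    same with [k']. *)
Lemma weight_class k k' n l c : k' = k + c ->
  O k < n <= O k.+1 -> O k' < n + l <= O k'.+1 -> ones w (n + l) = ones w n + c.
Proof.
move=> e h h'; have := gal k n; have := gal k.+1 n.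
by have := gal k' (n + l); have := gal k'.+1 (n + l); lia.
Qed.

Lemma not_weight_class k k' n l c : k' = k + c ->
  O k < n <= O k.+1 -> n + l <= O k' \/ O k'.+1 < n + l ->
  ones w (n + l) <> ones w n + c.
Proof.
move=> e h h'; have := gal k n; have := gal k.+1 n.
by have := gal k' (n + l); have := gal k'.+1 (n + l); lia.
Qed.

End OnesPositions.

(* [B k] tells whether the gap between the 1s at [O k] and [O k.+1] is the long one. *)
Section Isolated.
Variables (w : infinite_word bool) (O : nat -> nat) (K a b : nat) (B : nat -> bool).
Hypothesis rw : recurrent w.
Hypothesis good : two_or_three_returns w.
Hypothesis gal : forall k n, (n <= O k) = (ones w n <= K + k).
Hypothesis OS : forall k, O k.+1 = O k + (if B k then b else a).
Hypothesis a2 : 2 <= a.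
Hypothesis ab : a + 2 <= b.

Lemma gapA k : B k = false -> O k.+1 = O k + a.
Proof. by rewrite OS => ->. Qed.

Lemma gapB k : B k = true -> O k.+1 = O k + b.
Proof. by rewrite OS => ->. Qed.

Lemma gap_ge k : O k + a <= O k.+1.
Proof. by rewrite OS; case: (B k); lia. Qed.

(** The window of length [a + b] begins with [a.-1] 0s before a long gap and ends on the 1 closing
    it; one step further it loses a 0 and gains a 0. *)
Lemma mixed_return0 k : B k.+1 = true ->
  exists p, weight_return w (a + b) 2 p p.+1 /\ w p = false.
Proof.
move=> /gapB g; have h := gap_ge k; have h' := gap_ge k.+2.
exists (O k.+1 - a.-1); split; last by apply: (@w_gap w O K gal k); lia.
by apply: weight_return_step; apply: (@weight_class w O K gal k k.+2); lia.
Qed.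

Lemma mixed_return1 k : B k.+1 = true -> B k.+2 = false ->
  weight_return w (a + b) 2 (O k.+1) (O k.+1).+1.
Proof.
move=> /gapB g /gapA g'; have h := gap_ge k; have h' := gap_ge k.+3.
apply: weight_return_step; first by apply: (@weight_class w O K gal k k.+2); lia.
by apply: (@weight_class w O K gal k.+1 k.+3); lia.
Qed.

Lemma mixed_return_long k : B k.+1 = true -> B k.+2 = true ->
  exists j, weight_return w (a + b) 2 (O k.+1) j /\ 2 <= j - O k.+1.
Proof.
move=> /gapB g /gapB g'; have h := gap_ge k.
apply: next_long_return => // [|x xd]; first by apply: (@weight_class w O K gal k k.+2); lia.
have -> : x = 1 by lia.
by rewrite addn1; apply: (@not_weight_class w O K gal k.+1 k.+3); lia.
Qed.

Lemma mixed_return_short k : B k = true -> B k.+1 = false -> B k.+2 = false ->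
  exists i j, [/\ weight_return w (a + b) 2 i j, 2 <= j - i & w i = false].
Proof.
move=> /gapB g /gapA g' /gapA g''.
have [||j [r d]] := @next_long_return w (a + b) 2 (O k + a) 2 rw.
- by apply: (@weight_class w O K gal k k.+2); lia.
- move=> x xd; have -> : x = 1 by lia.
  by rewrite addn1; apply: (@not_weight_class w O K gal k k.+2); lia.
by exists (O k + a), j; split=> //; apply: (@w_gap w O K gal k); lia.
Qed.

(** The returns are 0, 1, a longer one starting with 1 and a longer one starting with 0. The last
    three come from the gaps long short, long long, and long short short. *)
Lemma isolated_mixed k1 k2 k3 : B k1.+1 = true -> B k1.+2 = false ->
  B k2.+1 = true -> B k2.+2 = true ->
  B k3 = true -> B k3.+1 = false -> B k3.+2 = false -> False.
Proof.
move=> B1 A1 B2 B2' B3 A3 A3'.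
have [p [r1 wp]] := mixed_return0 B1; have r2 := mixed_return1 B1 A1.
have [j3 [r3 d3]] := mixed_return_long B2 B2'.
have [i4 [j4 [r4 d4 w4]]] := mixed_return_short B3 A3 A3'.
have w1 := w_O gal k1.+1; have w3 := w_O gal k2.+1.
apply: (no_four_returns good r1 r2 r3 r4).
- by apply: block_neq_head; rewrite ?subSnn // wp w1.
- by apply: block_neq_size; rewrite subSnn; clear -d3; lia.
- by apply: block_neq_size; rewrite subSnn; clear -d4; lia.
- by apply: block_neq_size; rewrite subSnn; clear -d3; lia.
- by apply: block_neq_size; rewrite subSnn; clear -d4; lia.
- by apply: block_neq_head; rewrite ?w3 ?w4 //; exact: leq_trans d3.
Qed.

Lemma locate k m n : O k < n <= O (k + m) -> exists q, [/\ k <= q, q < k + m & O q < n <= O q.+1].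
Proof.
elim: m => [|m IH]; first by rewrite addn0; lia.
rewrite addnS; case: (ltnP (O (k + m)) n) => h1 h2; first by exists (k + m); split; lia.
by have [|q [q1 q2 q3]] := IH; [lia|exists q; split; lia].
Qed.

Lemma regular_gaps k t g : (forall q, k <= q < t -> O q.+1 = O q + g) ->
  k <= t -> O t = O k + (t - k) * g.
Proof.
move=> h kt; have : forall i, i <= t - k -> O (k + i) = O k + i * g.
  elim=> [|i IH] im; first by rewrite !addn0.
  by rewrite addnS h ?IH; lia.
by move=> /(_ _ (leqnn _)); rewrite subnKC.
Qed.

Lemma short_gaps_length k t : k < t -> (forall q, k < q <= t -> B q = false) ->
  O t.+1 = O k.+1 + (t - k) * a.
Proof.
move=> kt A; rewrite -subSS; apply: regular_gaps; last by lia.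
by move=> q qm; apply: gapA; apply: A; lia.
Qed.

(** The first window stops just before the second 1 after the long gap. From then on every window of
    length [2 * a] holds two 1s, until the 1 at [O t] drops out. Each further short gap adds [a] to
    the length. *)
Lemma short_gaps_return k t : k < t -> B k = true -> B t.+1 = true ->
  (forall q, k < q <= t -> B q = false) ->
  weight_return w (2 * a) 1 (O k.+1 - a) (O t.+1 - a.-1).
Proof.
move=> kt /gapB g /gapB g' A.
have len := short_gaps_length kt A.
have lastA : O t.+1 = O t + a by apply: gapA; apply: A; lia.
have h1 := gap_ge k; have h2 := gap_ge t.+2.
have firstA : O k.+2 = O k.+1 + a by apply: gapA; apply: A; lia.
have ml : a <= (t - k) * a by rewrite leq_pmull //; lia.
split; first by lia.
- by apply: (@weight_class w O K gal k k.+1); lia.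
- by apply: (@weight_class w O K gal t t.+1); lia.
move=> n /andP[n1 n2].
have [q [q1 q2 q3]] : exists q, [/\ k <= q, q < t.+1 & O q < n <= O q.+1].
  by have := @locate k (t.+1 - k) n; rewrite subnKC ?(leqW (ltnW kt)) //; apply; lia.
have q4 : q <> t by move=> e; rewrite e in q3; lia.
have gq : O q.+2 = O q.+1 + a by apply: gapA; apply: A; lia.
apply: (@not_weight_class w O K gal q q.+1) => //; [lia|right].
have [e|kq] : q = k \/ k < q by lia.
  by rewrite e in q3 gq *; lia.
have gq' : O q.+1 = O q + a by apply: gapA; apply: A; lia.
by lia.
Qed.

Lemma short_gaps_return0 k : B k = false -> B k.+1 = true ->
  weight_return w (2 * a) 1 (O k).+1 (O k).+2.
Proof.
move=> /gapA g /gapB g'.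
by apply: weight_return_step; apply: (@weight_class w O K gal k k.+1); lia.
Qed.

Lemma short_gaps_cross k : B k = false -> B k.+1 = true ->
  exists i j, weight_return w (2 * a) 1 i j /\
    (w i = true \/ 1 < j - i < a).
Proof.
move=> /gapA g /gapB g'; have h := gap_ge k.+2.
(* If [2 * a <= b], the window starting on the 1 before the long gap holds no other 1. Otherwise
   windows can contain both ends of the gap, and passing over these takes [2 * a - b + 1]
   letters. *)
have [big|small] := leqP (2 * a) b.
  have [||j [r _]] := @next_long_return w (2 * a) 1 (O k.+1) 1 rw.
  - by apply: (@weight_class w O K gal k k.+1); lia.
  - by move=> x; lia.
  by exists (O k.+1), j; split=> //; left; exact: (w_O gal).
exists (O k.+2 - 2 * a), (O k.+1).+1; split; last by right; lia.
split; first by lia.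
- by apply: (@weight_class w O K gal k k.+1); lia.
- by apply: (@weight_class w O K gal k.+1 k.+2); lia.
by move=> n /andP[n1 n2]; apply: (@not_weight_class w O K gal k k.+1); lia.
Qed.

Lemma isolated_short_gaps k t k' t' : k < t -> k' < t' -> t - k <> t' - k' ->
  B k = true -> B t.+1 = true -> (forall q, k < q <= t -> B q = false) ->
  B k' = true -> B t'.+1 = true -> (forall q, k' < q <= t' -> B q = false) ->
  False.
Proof.
move=> kt kt' mm Bk Bm A Bk' Bm' A'.
have r := short_gaps_return kt Bk Bm A; have r' := short_gaps_return kt' Bk' Bm' A'.
have A1 : B t = false by apply: A; lia.
have r0 := short_gaps_return0 A1 Bm.
have [i [j [ri wi]]] := short_gaps_cross A1 Bm.
have len := short_gaps_length kt A; have len' := short_gaps_length kt' A'.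
have gk := gapB Bk; have gk' := gapB Bk'; have gt := gapA A1.
have wk : w (O k.+1 - a) = false by apply: (@w_gap w O K gal k); clear -gk ab a2; lia.
have wk' : w (O k'.+1 - a) = false by apply: (@w_gap w O K gal k'); clear -gk' ab a2; lia.
have w0 : w (O t).+1 = false by apply: (@w_gap w O K gal t); clear -gt a2; lia.
have ml : a <= (t - k) * a by rewrite leq_pmull // subn_gt0.
have ml' : a <= (t' - k') * a by rewrite leq_pmull // subn_gt0.
have l1 : a < O t.+1 - a.-1 - (O k.+1 - a) by clear -len gk ml ab a2; lia.
have l2 : a < O t'.+1 - a.-1 - (O k'.+1 - a) by clear -len' gk' ml' ab a2; lia.
have ll : O t.+1 - a.-1 - (O k.+1 - a) <> O t'.+1 - a.-1 - (O k'.+1 - a).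
  move=> e; apply: mm.
  have : (t - k) * a = (t' - k') * a.
    by clear -e len len' gk gk' ml ml' ab a2; lia.
  move/eqP; rewrite eqn_pmul2r; last by clear -a2; lia.
  by move/eqP.
have [ij _ _ _] := ri; have ij0 : 0 < j - i by rewrite subn_gt0.
apply: (no_four_returns good r0 ri r r').
- case: wi => wi; first by apply: block_neq_head; rewrite ?subSnn // w0 wi.
  by apply: block_neq_size; rewrite subSnn; clear -wi; lia.
- by apply: block_neq_size; rewrite subSnn; clear -l1 a2; lia.
- by apply: block_neq_size; rewrite subSnn; clear -l2 a2; lia.
- case: wi => wi; first by apply: block_neq_head; rewrite // wi wk.
  by apply: block_neq_size; clear -wi l1; lia.
- case: wi => wi; first by apply: block_neq_head; rewrite // wi wk'.
  by apply: block_neq_size; clear -wi l2; lia.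
- exact: block_neq_size.
Qed.

Lemma long_gaps_length k u : k < u -> (forall q, k.+1 < q <= u.+1 -> B q = true) ->
  O u.+1 = O k.+2 + (u - k.+1) * b.
Proof.
move=> ku A; rewrite -(subSS k.+1); apply: regular_gaps; last by lia.
by move=> q qm; apply: gapB; apply: A; lia.
Qed.

(** The length fits a short and a long gap with their three 1s and one spare letter. Between two
    long gaps three 1s span [2 * b + 1] letters, which is too much since [a + 2 <= b]. *)
Lemma long_gaps_return k u : k < u -> B k.+1 = false -> B u.+2 = false ->
  (forall q, k.+1 < q <= u.+1 -> B q = true) ->
  weight_return w (a + b + 2) 3 (O k.+1) (O u.+1).-1.
Proof.
move=> ku /gapA g /gapA g' A.
have := long_gaps_length ku A; move: (_ * b) => X len.
have lastB : O u.+2 = O u.+1 + b by apply: gapB; apply: A; lia.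
have h1 := gap_ge k; have h2 := gap_ge u; have h3 := gap_ge u.+3; have h4 := gap_ge k.+3.
have firstB : O k.+3 = O k.+2 + b by apply: gapB; apply: A; lia.
split; first by clear -len g a2; lia.
- by apply: (@weight_class w O K gal k k.+3); lia.
- by apply: (@weight_class w O K gal u u.+3); lia.
move=> n /andP[n1 n2].
have [q [q1 q2 q3]] : exists q, [/\ k.+1 <= q, q < u.+1 & O q < n <= O q.+1].
  by have := @locate k.+1 (u.+1 - k.+1) n; rewrite subnKC ?(leqW ku) //; apply; lia.
apply: (@not_weight_class w O K gal q q.+3) => //; [lia|left].
have [e|qu] : q = u \/ q < u by lia.
  by rewrite e in q3 *; lia.
have gq : O q.+2 = O q.+1 + b by apply: gapB; apply: A; lia.
have gq' : O q.+3 = O q.+2 + b by apply: gapB; apply: A; lia.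
by lia.
Qed.

Lemma long_gaps_return0 u : B u.+1 = true -> B u.+2 = false ->
  weight_return w (a + b + 2) 3 (O u.+1).-1 (O u.+1).-1.+1.
Proof.
move=> /gapB g /gapA g'; have h := gap_ge u; have h' := gap_ge u.+3.
by apply: weight_return_step; apply: (@weight_class w O K gal u u.+3); lia.
Qed.

Lemma long_gaps_return1 u : B u.+1 = true -> B u.+2 = false -> B u.+3 = true ->
  weight_return w (a + b + 2) 3 (O u.+1) (O u.+2).-1.
Proof.
move=> /gapB g /gapA g' /gapB g''; have h := gap_ge u; have h' := gap_ge u.+4.
split; first by lia.
- by apply: (@weight_class w O K gal u u.+3); lia.
- by apply: (@weight_class w O K gal u.+1 u.+4); lia.
by move=> n /andP[n1 n2]; apply: (@not_weight_class w O K gal u.+1 u.+4); lia.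
Qed.

Lemma isolated_long_gaps k u k' u' : k < u -> k' < u' -> u - k <> u' - k' ->
  B k.+1 = false -> B u.+2 = false -> (forall q, k.+1 < q <= u.+1 -> B q = true) ->
  B k'.+1 = false -> B u'.+2 = false -> (forall q, k'.+1 < q <= u'.+1 -> B q = true) ->
  B u.+3 = true -> False.
Proof.
move=> ku ku' mm Bk Bu A Bk' Bu' A' Bu3.
have r := long_gaps_return ku Bk Bu A; have r' := long_gaps_return ku' Bk' Bu' A'.
have B1 : B u.+1 = true by apply: A; lia.
have r0 := long_gaps_return0 B1 Bu; have r1 := long_gaps_return1 B1 Bu Bu3.
have len := long_gaps_length ku A; have len' := long_gaps_length ku' A'.
have gk := gapA Bk; have gk' := gapA Bk'; have gu := gapB B1; have hu := gap_ge u.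
have w0 : w (O u.+1).-1 = false by apply: (@w_gap w O K gal u); clear -hu a2; lia.
have w1 := w_O gal u.+1; have wk := w_O gal k.+1; have wk' := w_O gal k'.+1.
have l1 : (O u.+2).-1 - O u.+1 = b.-1 by clear -gu; lia.
have l2 : (O u.+1).-1 - O k.+1 = a.-1 + (u - k.+1) * b by rewrite len gk; move: (_ * b) => X; clear -X a2; lia.
have l3 : (O u'.+1).-1 - O k'.+1 = a.-1 + (u' - k'.+1) * b by rewrite len' gk'; move: (_ * b) => X; clear -X a2; lia.
(* The return across long short long has length [b.-1]; the two that depend on the number of long
   gaps have length [a.-1] modulo [b]. *)
have nb m : b.-1 <> a.-1 + m * b.
  case: m => [|m]; first by clear -ab a2; lia.
  by rewrite mulSn; move: (_ * b) => X; clear -X a2 ab; lia.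
apply: (no_four_returns good r0 r1 r r'); rewrite ?subSnn ?l1 ?l2 ?l3.
- by apply: block_neq_head; rewrite // w0 w1.
- by apply: block_neq_head; rewrite // w0 wk.
- by apply: block_neq_head; rewrite // w0 wk'.
- exact: block_neq_size.
- exact: block_neq_size.
- apply: block_neq_size => /addnI/eqP; rewrite eqn_pmul2r; last by clear -ab; lia.
  by move=> /eqP; clear -mm ku ku'; lia.
Qed.

End Isolated.

(** * Long runs of a constant length *)

(* Each run of 1s ends at some [O i]; it is followed by [z i] 0s, then [r] 1s. *)
Section Runs.
Variables (w : infinite_word bool) (O : nat -> nat) (r s t : nat) (B : nat -> bool).
Let z i := if B i then t else s.
Hypothesis rw : recurrent w.
Hypothesis good : two_or_three_returns w.
Hypothesis OS : forall i, O i.+1 = O i + z i + r.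
Hypothesis zeros : forall i n, O i < n <= O i + z i -> w n = false.
Hypothesis onesO : forall i n, O i + z i < n <= O i.+1 -> w n = true.
Hypothesis r2 : 2 <= r.
Hypothesis s1 : 1 <= s.
Hypothesis st : s < t.

Lemma run_short i : B i = false -> O i.+1 = O i + s + r /\ z i = s.
Proof. by rewrite OS /z => ->. Qed.

Lemma run_long i : B i = true -> O i.+1 = O i + t + r /\ z i = t.
Proof. by rewrite OS /z => ->. Qed.

Lemma ones_zeros i n : O i < n <= O i + z i + 1 -> ones w n = ones w (O i).+1.
Proof.
case/andP; move=> /subnK <-; elim: (n - _) => [|d IH]; first by rewrite add0n.
rewrite addSn onesS => h; rewrite (@zeros i); last by lia.
by rewrite addn0 IH //; lia.
Qed.

Lemma ones_run i x : x <= r -> ones w (O i + z i + 1 + x) = ones w (O i).+1 + x.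
Proof.
elim: x => [|x IH] xr; first by rewrite !addn0 (@ones_zeros i) //; lia.
rewrite addnS onesS IH ?(ltnW xr) // (@onesO i); first by lia.
by rewrite OS; lia.
Qed.

Lemma ones_next i : ones w (O i.+1).+1 = ones w (O i).+1 + r.
Proof. by rewrite -(ones_run i (leqnn r)) OS addn1 addSn. Qed.

Lemma ones_run_ge i x n : x <= r -> O i + z i + 1 + x <= n ->
  ones w (O i).+1 + x <= ones w n.
Proof. by move=> xr h; rewrite -ones_run //; case/andP: (ones_mono w h). Qed.

Lemma w_end i : w (O i.+1) = true.
Proof. by apply: (@onesO i); rewrite OS; lia. Qed.

Lemma ones_end i : (ones w (O i.+1)).+1 = ones w (O i.+1).+1.
Proof. by rewrite onesS w_end addn1. Qed.

(** With weight [r.+1] this fits a run of 1s, one further 1, and as many 0s as a short and a long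
    run have together. *)
Let l := s + t + r + 1.

Lemma run_class_end i : B i.+1 = false -> B i.+2 = true ->
  ones w (O i.+1 + l) = ones w (O i.+1) + r.+1.
Proof.
move=> /run_short[g e] /run_long[g' e']; have h := ones_end i; have h' := ones_next i.+1.
by rewrite [LHS](@ones_zeros i.+2) ?e' /l; lia.
Qed.

Lemma run_class_start i : B i.+1 != B i.+2 ->
  ones w ((O i.+1).+1 + l) = ones w (O i.+1).+1 + r.+1.
Proof.
move=> BB; have h' := ones_next i.+1.
have -> : (O i.+1).+1 + l = O i.+2 + z i.+2 + 1 + 1.
  by rewrite (OS i.+1) /l /z; case: (B i.+1) (B i.+2) BB => -[] //= _; lia.
by rewrite ones_run; lia.
Qed.

Lemma run_return1 i : B i.+1 = false -> B i.+2 = true ->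
  weight_return w l r.+1 (O i.+1) (O i.+1).+1.
Proof.
move=> A1 B2; apply: weight_return_step; first exact: run_class_end.
by apply: run_class_start; rewrite A1 B2.
Qed.

(** The window ends on the first 1 of a run. During the next [s] steps it loses only 0s and has
    taken in a second 1, which exists as [2 <= r]. *)
Lemma run_return0 i : B i.+1 != B i.+2 ->
  exists j, weight_return w l r.+1 (O i.+1).+1 j /\ s.+1 <= j - (O i.+1).+1.
Proof.
move=> BB; apply: next_long_return => //; first exact: run_class_start.
move=> x xs; have h' := ones_next i.+1.
have zge : s <= z i.+1 by rewrite /z; case: (B _); lia.
rewrite [X in _ <> X + _](@ones_zeros i.+1); last by lia.
have : ones w (O i.+2).+1 + 2 <= ones w ((O i.+1).+1 + x + l).
  apply: ones_run_ge => //.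
  by rewrite (OS i.+1) /l /z; case: (B i.+1) (B i.+2) BB => -[] //= _; lia.
by lia.
Qed.

Lemma run_return_long i : B i.+1 = true -> B i.+2 = true ->
  exists j, weight_return w l r.+1 (O i.+1) j /\ 2 <= j - O i.+1.
Proof.
move=> /run_long[g e] /run_long[g' e']; have h := ones_end i; have h' := ones_next i.+1.
apply: next_long_return => // [|x xd].
  by rewrite [LHS](@ones_zeros i.+2) ?e' /l; lia.
have -> : x = 1 by lia.
rewrite [X in X <> _](@ones_zeros i.+2) ?e' /l; last by lia.
by rewrite addn1; lia.
Qed.

(** The returns are 1, a longer one starting with 1, and two starting with 0 that differ at index
    [s], where a short run has ended and a long one has not. *)
Lemma runs_mixed i1 i2 i3 : B i1.+1 = false -> B i1.+2 = true ->
  B i2.+1 = true -> B i2.+2 = true -> B i3.+1 = true -> B i3.+2 = false -> False.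
Proof.
move=> A1 B1 B2 B2' B3 A3.
have w1 := w_end i1; have w2 := w_end i2.
have [_ e1] := run_short A1; have [_ e3] := run_long B3.
have w0 : w (O i1.+1).+1 = false by apply: (@zeros i1.+1); rewrite e1; clear -s1; lia.
have w0' : w (O i3.+1).+1 = false by apply: (@zeros i3.+1); rewrite e3; clear -s1 st; lia.
have ws : w ((O i1.+1).+1 + s) = true.
  by apply: (@onesO i1.+1); rewrite (OS i1.+1) e1; clear -r2; lia.
have ws' : w ((O i3.+1).+1 + s) = false.
  by apply: (@zeros i3.+1); rewrite e3; clear -st; lia.
have R1 := run_return1 A1 B1.
have [|j2 [R2 d2]] := @run_return0 i1; first by rewrite A1 B1.
have [j3 [R3 d3]] := run_return_long B2 B2'.
have [|j4 [R4 d4]] := @run_return0 i3; first by rewrite B3 A3.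
apply: (no_four_returns good R1 R2 R3 R4).
- by apply: block_neq_head; rewrite ?subSnn // w1 w0.
- by apply: block_neq_size; rewrite subSnn; clear -d3; lia.
- by apply: block_neq_head; rewrite ?subSnn // w1 w0'.
- by apply: block_neq_head; rewrite ?w0 ?w2 //; clear -d2; lia.
- by apply: (@block_neq_nth _ s) => //; rewrite ws ws'.
- by apply: block_neq_head; rewrite ?w0' ?w2 //; clear -d3; lia.
Qed.

Lemma short_runs_length k v : k < v -> (forall q, k.+1 < q <= v.+1 -> B q = false) ->
  O v.+1 = O k.+2 + (v - k.+1) * (s + r).
Proof.
move=> kv A; have : forall i, i <= v - k.+1 -> O (k.+2 + i) = O k.+2 + i * (s + r).
  elim=> [|i IH] iv; first by rewrite !addn0.
  rewrite addnS; have [|-> _] := @run_short (k.+2 + i); first by apply: A; lia.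
  by rewrite IH; lia.
by move=> /(_ _ (leqnn _)); have -> : k.+2 + (v - k.+1) = v.+1 by lia.
Qed.

Lemma locate_run k v n : k <= v -> O k < n <= O v ->
  exists q, [/\ k <= q, q < v & O q < n <= O q.+1].
Proof.
move=> /subnKC <-; elim: (v - k) => [|m IH]; first by rewrite addn0; lia.
rewrite addnS; case: (ltnP (O (k + m)) n) => h1 h2; first by exists (k + m); split; lia.
by have [|q [q1 q2 q3]] := IH; [lia|exists q; split; lia].
Qed.

Lemma short_runs_return k v : k < v -> B k.+1 = true -> B v.+2 = true ->
  (forall q, k.+1 < q <= v.+1 -> B q = false) ->
  weight_return w l r.+1 (O k.+1).+1 (O v.+1).
Proof.
move=> kv B1 B2 A.
have := short_runs_length kv A; move: (_ * _) => X len.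
have [g e] := run_long B1.
have A2 : B k.+2 = false by apply: A; lia.
have A1 : B v.+1 = false by apply: A; lia.
split; first by lia.
- by apply: run_class_start; rewrite B1 A2.
- exact: run_class_end.
move=> n /andP[n1 n2].
have [q [q1 q2 q3]] : exists q, [/\ k.+1 <= q, q < v.+1 & O q < n <= O q.+1].
  by apply: locate_run; lia.
have [g1 e1] : O q.+2 = O q.+1 + s + r /\ z q.+1 = s by apply: run_short; apply: A; lia.
have p1 := ones_next q; have p2 := ones_next q.+1.
(* As long as the runs of 0s ahead are short, the window is too heavy, so the return lasts through
   all of them. *)
suff : ones w n + r.+2 <= ones w (n + l) by lia.
have gq := OS q.
have [nz|nz] := leqP n (O q + z q + 1).
  rewrite (@ones_zeros q); last by lia.
  have : ones w (O q.+1).+1 + 2 <= ones w (n + l).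
    apply: ones_run_ge => //; rewrite e1 /l.
    have [qk|qk] : q = k.+1 \/ k.+1 < q by lia.
      by rewrite qk in q3 g1 gq nz *; lia.
    have [|_ e2] := @run_short q; first by apply: A; lia.
    by lia.
  by lia.
have [h [h0 hr en]] : exists h, [/\ 0 < h, h < r & n = O q + z q + 1 + h].
  by exists (n - (O q + z q + 1)); split; lia.
have -> : ones w n = ones w (O q).+1 + h by rewrite en ones_run //; lia.
have enl : n + l = O q.+1 + z q.+1 + 1 + (t + 1 + h) by rewrite e1 /l; lia.
have [small|big] := leqP (t + 1 + h) r.
  by rewrite enl ones_run //; lia.
have ge1 : ones w (O q.+1).+1 + r <= ones w (n + l).
  by apply: ones_run_ge => //; lia.
(* [h] is the number of 1s of the current run already left behind. When one remains, the window has
   to reach a 1 of the second next run, and it does because the 0s before that run are only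
   [s < t]. *)
have [hr2|hr1] : h + 2 <= r \/ h = r.-1 by lia.
  by lia.
have qv : q <> v by move=> e0; move: n2 en; rewrite -e0 gq hr1; clear -r2; lia.
have [|_ e3] := @run_short q.+2; first by apply: A; lia.
have : ones w (O q.+2).+1 + 1 <= ones w (n + l).
  by apply: ones_run_ge; lia.
by lia.
Qed.

Lemma runs_short k v k' v' : k < v -> k' < v' -> v - k <> v' - k' ->
  B k.+1 = true -> B v.+2 = true -> (forall q, k.+1 < q <= v.+1 -> B q = false) ->
  B k'.+1 = true -> B v'.+2 = true -> (forall q, k'.+1 < q <= v'.+1 -> B q = false) ->
  False.
Proof.
move=> kv kv' mm B1 B2 A B1' B2' A'.
have R3 := short_runs_return kv B1 B2 A; have R4 := short_runs_return kv' B1' B2' A'.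
have A1 : B v.+1 = false by apply: A; lia.
have w1 := w_end v; have [_ e1] := run_short A1.
have [g3 e3] := run_long B1; have [g4 e4] := run_long B1'.
have w0 : w (O v.+1).+1 = false by apply: (@zeros v.+1); rewrite e1; clear -s1; lia.
have w3 : w (O k.+1).+1 = false by apply: (@zeros k.+1); rewrite e3; clear -s1 st; lia.
have w4 : w (O k'.+1).+1 = false by apply: (@zeros k'.+1); rewrite e4; clear -s1 st; lia.
have ws : w ((O v.+1).+1 + s) = true.
  by apply: (@onesO v.+1); rewrite (OS v.+1) e1; clear -r2; lia.
have ws3 : w ((O k.+1).+1 + s) = false.
  by apply: (@zeros k.+1); rewrite e3; clear -st; lia.
have ws4 : w ((O k'.+1).+1 + s) = false.
  by apply: (@zeros k'.+1); rewrite e4; clear -st; lia.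
have R1 := run_return1 A1 B2.
have [|j2 [R2 d2]] := @run_return0 v; first by rewrite A1 B2.
have l3 : O v.+1 - (O k.+1).+1 = t + r.-1 + (v - k.+1) * (s + r).
  by rewrite (short_runs_length kv A) g3; move: (_ * _) => X; clear -X r2; lia.
have l4 : O v'.+1 - (O k'.+1).+1 = t + r.-1 + (v' - k'.+1) * (s + r).
  by rewrite (short_runs_length kv' A') g4; move: (_ * _) => X; clear -X r2; lia.
apply: (no_four_returns good R1 R2 R3 R4).
- by apply: block_neq_head; rewrite ?subSnn // w1 w0.
- by apply: block_neq_head; rewrite ?subSnn // w1 w3.
- by apply: block_neq_head; rewrite ?subSnn // w1 w4.
- by apply: (@block_neq_nth _ s) => //; rewrite ws ws3.
- by apply: (@block_neq_nth _ s) => //; rewrite ws ws4.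
- rewrite l3 l4; apply: block_neq_size => /addnI/eqP; rewrite eqn_pmul2r; last by clear -s1; lia.
  by move=> /eqP; clear -mm kv kv'; lia.
Qed.

End Runs.

(** * Decomposition into runs *)

Lemma next_letter w b n : recurrent w -> (exists m, w m = b) ->
  exists m, [/\ n < m, w m = b & forall x, n < x < m -> w x = ~~ b].
Proof.
move=> rw [m0 wm0]; have ex : exists m, (n < m) && (w m == b).
  have [m nm e] := recurrentP rw m0 1 n.+1; exists m; apply/andP; split=> //.
  by have := e 0 isT; rewrite !addn0 => ->; rewrite wm0.
case: (ex_minnP ex) => m /andP[nm /eqP wm] mmin; exists m; split=> // x /andP[nx xm].
have := mmin x; rewrite nx; case: eqP => [_ /(_ isT)|]; first by lia.
by case: (w x); case: (b).
Qed.

(* The letters before [O 0], the end of some run of 1s, are not constrained. *)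
Definition run_decomposition w (O z r : nat -> nat) := w (O 0) = true /\ forall i,
  [/\ 0 < z i, 0 < r i, O i.+1 = O i + z i + r i,
      forall n, O i < n <= O i + z i -> w n = false
    & forall n, O i + z i < n <= O i.+1 -> w n = true].

Lemma run_decomposition_exists w : recurrent w ->
  (exists m, w m = false) -> (exists m, w m = true) ->
  exists O z r, run_decomposition w O z r.
Proof.
move=> rw w0 w1.
have step e : exists zr : nat * nat, w e.+1 = false ->
    [/\ 0 < zr.1, 0 < zr.2, forall n, e < n <= e + zr.1 -> w n = false,
        forall n, e + zr.1 < n <= e + zr.1 + zr.2 -> w n = true
      & w (e + zr.1 + zr.2).+1 = false].
  have [m [em wm m0]] := next_letter e rw w1.
  have [p [mp wp p1]] := next_letter m rw w0.
  exists (m - e.+1, p - m) => we /=.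
  have [em1|em1] : m = e.+1 \/ e.+1 < m by lia.
    by rewrite em1 we in wm.
  split; [lia|lia| | |].
  - by move=> n ne; rewrite m0 //; lia.
  - move=> n ne; have [->//|nm] : n = m \/ n <> m by lia.
    by rewrite p1 //; lia.
  - by rewrite -wp; congr w; lia.
have [f fP] := choice step.
have [a [_ wa _]] := next_letter 0 rw w1.
have [b [ab wb ba]] := next_letter a rw w0.
(* [b.-1] is the last 1 before the 0 at [b]; iteration keeps a 0 after each [O i], the condition
   under which [fP] says something. *)
pose O i := iter i (fun e => e + (f e).1 + (f e).2) b.-1.
exists O, (fun i => (f (O i)).1), (fun i => (f (O i)).2).
have wO i : w (O i).+1 = false.
  elim: i => [|i IH]; first by rewrite /O /= prednK ?wb //; lia.
  by rewrite /O iterS -/(O i); case: (fP _ IH).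
split=> [|i]; last by have [] := fP _ (wO i).
rewrite /O /=; have [->//|ab'] : b.-1 = a \/ b.-1 <> a by lia.
by rewrite ba //; lia.
Qed.

Section Decomposition.
Variables (w : infinite_word bool) (O z r : nat -> nat).
Hypothesis rw : recurrent w.
Hypothesis rd : run_decomposition w O z r.

Lemma rd_z0 i : 0 < z i. Proof. by have [] := rd.2 i. Qed.
Lemma rd_r0 i : 0 < r i. Proof. by have [] := rd.2 i. Qed.
Lemma rdS i : O i.+1 = O i + z i + r i. Proof. by have [] := rd.2 i. Qed.

Lemma rd_zeros i n : O i < n <= O i + z i -> w n = false.
Proof. by have [_ _ _ h _] := rd.2 i; exact: h. Qed.

Lemma rd_ones i n : O i + z i < n <= O i.+1 -> w n = true.
Proof. by have [_ _ _ _ h] := rd.2 i; exact: h. Qed.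

Lemma rd_end i : w (O i) = true.
Proof.
case: i => [|i]; first by case: rd.
by apply: (@rd_ones i); rewrite rdS; have := rd_r0 i; lia.
Qed.

Lemma rd_endS i : w (O i).+1 = false.
Proof. by apply: (@rd_zeros i); have := rd_z0 i; lia. Qed.

Lemma rd_ltS i : O i < O i.+1.
Proof. by rewrite rdS; have := rd_z0 i; lia. Qed.

Lemma rd_lt i j : i < j -> O i < O j.
Proof.
elim: j => [//|j IH]; rewrite ltnS leq_eqVlt => /orP[/eqP ->|/IH h]; first exact: rd_ltS.
exact: ltn_trans h (rd_ltS j).
Qed.

Lemma rd_le i j : (O i <= O j) = (i <= j).
Proof.
case: (ltngtP i j) => [/rd_lt/ltnW ->|/rd_lt|->] //; last by rewrite leqnn.
by rewrite ltnNge => /negbTE.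
Qed.

Lemma rd_locate n : O 0 < n -> exists q, O q < n <= O q.+1.
Proof.
move=> n0; have ex : exists q, n <= O q.
  exists n; elim: {n0} n => [//|n IH]; exact: leq_ltn_trans IH (rd_ltS n).
case: (ex_minnP ex) => -[|q] nq qmin; first by lia.
by exists q; rewrite nq andbT ltnNge; apply/negP => /qmin; lia.
Qed.

Lemma rd_end_index n : O 0 <= n -> w n = true -> w n.+1 = false -> exists i, n = O i.
Proof.
rewrite leq_eqVlt => /orP[/eqP <-|/rd_locate[q qn]] wn wn'; first by exists 0.
exists q.+1; apply: contrapT => nq.
have [h|h] := leqP n (O q + z q).
  by rewrite (@rd_zeros q) in wn; lia.
by rewrite (@rd_ones q) in wn'; lia.
Qed.

Lemma rd_pattern i L k : exists2 i', k <= i' &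
  forall y, y < L -> z (i' + y) = z (i + y) /\ r (i' + y) = r (i + y).
Proof.
(* The window runs from the last 1 of a run to the 0 after [O (i + L)]: its first two letters 10
   place the copy at the end of a run, and its final 0 fixes the length of the last run. *)
have [m km e] := recurrentP rw (O i) (O (i + L) - O i).+2 (O k).
have iL y : y <= L -> O (i + y) <= O (i + L) by rewrite rd_le leq_add2l.
have [i' mi] : exists i', m = O i'.
  apply: rd_end_index; first by apply: leq_trans km; rewrite rd_le.
    by have := e 0 isT; rewrite !addn0 rd_end.
  by have := e 1 isT; rewrite !addn1 rd_endS.
exists i'; first by rewrite -rd_le -mi.
have eq x y : y <= L -> O (i' + y) + O i = O (i + y) + O i' -> O (i + y) + x <= (O (i + L)).+1 ->
    w (O (i' + y) + x) = w (O (i + y) + x).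
  move=> yL h hx; have := e (O (i + y) - O i + x); have iy : O i <= O (i + y) by rewrite rd_le leq_addr.
  have -> : m + (O (i + y) - O i + x) = O (i' + y) + x by rewrite mi; lia.
  have -> : O i + (O (i + y) - O i + x) = O (i + y) + x by lia.
  by apply; lia.
suff H y : y <= L -> O (i' + y) + O i = O (i + y) + O i' /\
    forall x, x < y -> z (i' + x) = z (i + x) /\ r (i' + x) = r (i + x).
  by move=> y yL; have [_ h] := H L (leqnn L); exact: h.
elim: y => [|y IH] yL; first by rewrite !addn0; split=> //; rewrite addnC.
have [h hx] := IH (ltnW yL).
have le : O (i + y).+1 <= O (i + L) by rewrite rd_le; lia.
have g := rdS (i + y); have g' := rdS (i' + y).
have zz : z (i' + y) = z (i + y).
  case: (ltngtP (z (i' + y)) (z (i + y))) => // lt; exfalso.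
    have := eq (z (i' + y)).+1 y (ltnW yL) h; rewrite (@rd_ones (i' + y)); last first.
      by have := rd_r0 (i' + y); lia.
    by rewrite (@rd_zeros (i + y)); [move=> /(_ _)|]; lia.
  have := eq (z (i + y)).+1 y (ltnW yL) h; rewrite (@rd_zeros (i' + y)); last by lia.
  by rewrite (@rd_ones (i + y)); have := rd_r0 (i + y); lia.
have rr : r (i' + y) = r (i + y).
  case: (ltngtP (r (i' + y)) (r (i + y))) => // lt; exfalso.
    have := eq (z (i' + y) + r (i' + y)).+1 y (ltnW yL) h.
    have -> : O (i' + y) + (z (i' + y) + r (i' + y)).+1 = (O (i' + y).+1).+1 by lia.
    by rewrite rd_endS (@rd_ones (i + y)); lia.
  have := eq (z (i + y) + r (i + y)).+1 y (ltnW yL) h.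
  have -> : O (i + y) + (z (i + y) + r (i + y)).+1 = (O (i + y).+1).+1 by lia.
  by rewrite rd_endS (@rd_ones (i' + y)); lia.
split; first by rewrite !addnS; lia.
by move=> x; rewrite ltnS leq_eqVlt => /orP[/eqP -> //|]; exact: hx.
Qed.

Lemma rd_same_word q q' m :
  (forall y, y < m -> z (q + y) = z (q' + y) /\ r (q + y) = r (q' + y)) ->
  O (q + m) + O q' = O (q' + m) + O q /\
  forall x, O q + x <= O (q + m) -> w (O q + x) = w (O q' + x).
Proof.
elim: m => [|m IH] h.
  rewrite !addn0; split=> [|x]; first by rewrite addnC.
  by rewrite -[X in _ <= X]addn0 leq_add2l leqn0 => /eqP ->; rewrite !addn0 !rd_end.
have [|l IHx] := IH; first by move=> y ym; apply: h; lia.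
have [zz rr] := h m (ltnSn m).
have g := rdS (q + m); have g' := rdS (q' + m).
split=> [|x xm]; first by rewrite !addnS; lia.
have [le|gt] := leqP (O q + x) (O (q + m)); first exact: IHx.
rewrite addnS in xm; have [hz|hz] := leqP (O q + x) (O (q + m) + z (q + m)).
  by rewrite (@rd_zeros (q + m)) ?(@rd_zeros (q' + m)) //; lia.
by rewrite (@rd_ones (q + m)) ?(@rd_ones (q' + m)) //; lia.
Qed.

End Decomposition.

Lemma ones_flatP w n l :
  ones w (n + l) = ones w n <-> forall x, x < l -> w (n + x) = false.
Proof.
elim: l => [|l IH]; first by rewrite addn0; split.
rewrite addnS onesS; split=> [e x|h].
  have /IH h : ones w (n + l) = ones w n.
    by have := @ones_mono w n (n + l); lia.
  rewrite ltnS leq_eqVlt => /orP[/eqP ->|]; last exact: h.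
  by move: e; rewrite (IH.2 h); case: (w _) => /=; lia.
by rewrite (IH.2 _) ?h // ?addn0 // => x xl; apply: h; lia.
Qed.

Lemma last_occurrence (B : nat -> bool) k k' b : k <= k' -> B k = b -> B k' = ~~ b ->
  exists i, [/\ k <= i, i < k', B i = b & forall q, i < q <= k' -> B q = ~~ b].
Proof.
elim: k' => [|k' IH] kk Bk Bk'.
  have k0 : k = 0 by lia.
  by move: Bk'; rewrite -k0 Bk; case: (b).
have [e|lt] : k = k'.+1 \/ k <= k' by lia.
  by move: Bk'; rewrite -e Bk; case: (b).
have [Bb|Bb] : B k' = b \/ B k' = ~~ b by case: (B k'); case: (b); auto.
  exists k'; split=> // q qk; have -> : q = k'.+1 by lia.
  by [].
have [i [ki ik Bi h]] := IH lt Bk Bb; exists i; split=> //; first by lia.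
move=> q qk; have [->//|nq] : q = k'.+1 \/ q <> k'.+1 by lia.
by apply: h; lia.
Qed.

Lemma rd_zero_run w O z r n l : run_decomposition w O z r -> O 0 < n -> 0 < l ->
  (forall x, x < l -> w (n + x) = false) ->
  exists q, O q < n /\ n + l <= (O q + z q).+1.
Proof.
move=> rd n0 l0 h; have [q /andP[q1 q2]] := rd_locate rd n0.
exists q; split=> //; have g := rdS rd q; have r0 := rd_r0 rd q.
have wn : w n = false by rewrite -[n]addn0 h.
have nz : n <= O q + z q.
  rewrite leqNgt; apply/negP => gt; rewrite (rd_ones rd (i := q)) in wn; lia.
rewrite leqNgt; apply/negP => gt.
have /h : (O q + z q).+1 - n < l by lia.
by rewrite subnKC ?(rd_ones rd (i := q)) //; lia.
Qed.

(** * Spacings of the longest runs of 0s *)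

Section LongRuns.
Variables (w : infinite_word bool) (O z r : nat -> nat) (t s : nat).
Hypothesis rw : recurrent w.
Hypothesis good : two_or_three_returns w.
Hypothesis rd : run_decomposition w O z r.
Hypothesis zt : forall i, z i <= t.
Hypothesis zts : forall i, z i = t \/ z i = s.

Lemma long_run_position n : O 0 < n -> ones w (n + t) = ones w n + 0 ->
  exists2 q, n = (O q).+1 & z q = t.
Proof.
rewrite addn0 => n0 /ones_flatP h.
have t0 : 0 < t by apply: leq_trans (zt 0); exact: rd_z0 rd 0.
have [q [qn nt]] := rd_zero_run rd n0 t0 h.
by exists q; have := zt q; lia.
Qed.

Lemma long_run_class q : z q = t -> ones w ((O q).+1 + t) = ones w (O q).+1 + 0.
Proof.
move=> zq; rewrite addn0; apply/ones_flatP => x xt.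
by apply: (rd_zeros rd (i := q)); lia.
Qed.

Lemma long_run_return i j : O 1 < i -> weight_return w t 0 i j ->
  exists k m, [/\ i = (O k).+1, j = (O (k + m)).+1, 0 < k, 0 < m &
    [/\ z k = t, z (k + m) = t & forall q, k < q < k + m -> z q <> t]].
Proof.
move=> i1 [ij ci cj no]; have O01 := rd_ltS rd 0.
have [k ik zk] := long_run_position (ltn_trans O01 i1) ci.
have [k' jk' zk'] := long_run_position (ltn_trans O01 (ltn_trans i1 ij)) cj.
have kk' : k < k'.
  rewrite ltnNge -(rd_le rd); apply/negP => h; lia.
exists k, (k' - k); rewrite subnKC ?(ltnW kk') //; split=> //; [|lia|split=> //].
  by rewrite -(rd_le rd); lia.
move=> q /andP[kq qk] zq; apply: (no (O q).+1); last exact: long_run_class.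
by have := rd_lt rd kq; have := rd_lt rd qk; lia.
Qed.

Hypothesis rc : forall i j, r i = r j.

(** A return to the block of [t] 0s leads from one longest run to the next. As all other runs have
    fixed lengths, it is determined by the number of runs crossed, so two returns give two
    spacings. *)
Lemma two_long_runs : (exists i, z i = t) -> exists k m k' m',
  [/\ 0 < k, 0 < m, 0 < k', 0 < m' & m <> m'] /\
  [/\ z k = t, z (k + m) = t & forall q, k < q < k + m -> z q <> t] /\
  [/\ z k' = t, z (k' + m') = t & forall q, k' < q < k' + m' -> z q <> t].
Proof.
move=> [i0 zi0]; have [|[i [j [i' [j' [ri ri' d]]]]] _] := good (l := t) (c := 0).
  by exists (O i0).+1; exact: long_run_class.
have [i1 [li1 ri1 b1]] := weight_return_recurs (O 1).+1 rw ri.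
have [i2 [li2 ri2 b2]] := weight_return_recurs (O 1).+1 rw ri'.
have [k [m [ik jk k0 m0 [zk zm A]]]] := long_run_return li1 ri1.
have [k' [m' [ik' jk' k0' m0' [zk' zm' A']]]] := long_run_return li2 ri2.
exists k, m, k', m'; split; [split=> // mm|by split].
apply: d; rewrite -b1 -b2.
have [|e h] := @rd_same_word w O z r rd k k' m.
  move=> y ym; split; last exact: rc.
  have [->|y0] : y = 0 \/ 0 < y by lia.
    by rewrite !addn0 zk zk'.
  have [/A [] //|->] := zts (k + y); first by lia.
  by have [/A' [] //|->] := zts (k' + y); first by lia.
rewrite -mm in jk'; have ji : j - i = j' - i' by lia.
rewrite -ji; apply/eq_blockP => x xl.
by rewrite ik ik' !addSnnS h //; lia.
Qed.

End LongRuns.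

(** * At most two distances between isolated 1s *)

Section IsolatedGaps.
Variables (w : infinite_word bool) (O : nat -> nat) (K a : nat).
Hypothesis gal : forall k n, (n <= O k) = (ones w n <= K + k).
Hypothesis a2 : 2 <= a.
Hypothesis gap : forall k, O k + a <= O k.+1.

Lemma wide_gap_return k : O k + a + 2 <= O k.+1 ->
  weight_return w a.+1 1 (O k.+1 - a) (O k.+1 - a).+1.
Proof.
move=> h; have h' := gap k.+1.
by apply: weight_return_step; apply: (@weight_class w O K gal (k) (k.+1)); lia.
Qed.

Lemma tight_gap_return k : O k.+2 = O k.+1 + a ->
  weight_return w a.+1 1 (O k.+1).-1 (O k.+1).+1.
Proof.
move=> h; have h' := gap k; have h'' := gap k.+2.
split; first by lia.
- by apply: (@weight_class w O K gal (k) (k.+1)); lia.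
- by apply: (@weight_class w O K gal (k.+1) (k.+2)); lia.
by move=> n n1; apply: (@not_weight_class w O K gal (k) (k.+1)); lia.
Qed.

Lemma gap_return k : O k.+1 + a < O k.+2 ->
  weight_return w a.+1 1 (O k.+1) (O k.+2 - a).
Proof.
move=> h; have h' := gap k; have h'' := gap k.+2.
split; first by lia.
- by apply: (@weight_class w O K gal (k) (k.+1)); lia.
- by apply: (@weight_class w O K gal (k.+1) (k.+2)); lia.
by move=> n n1; apply: (@not_weight_class w O K gal (k.+1) (k.+2)); lia.
Qed.

(** The class has length [a.+1] and weight 1. A gap of at least [a + 2] yields the return 0, a gap
    [a] yields 01, and each gap g above [a] yields a return of length g - [a] starting with 1. *)
Lemma at_most_two_gaps k0 k1 k k' : two_or_three_returns w ->
  O k0 + a + 2 <= O k0.+1 -> O k1.+2 = O k1.+1 + a ->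
  O k.+1 + a < O k.+2 -> O k'.+1 + a < O k'.+2 ->
  O k.+2 - O k.+1 = O k'.+2 - O k'.+1.
Proof.
move=> good g0 g1 g g'; apply: contrapT => d.
have R1 := wide_gap_return g0; have R2 := tight_gap_return g1.
have R3 := gap_return g; have R4 := gap_return g'.
have h := gap k1.
have w1 : w (O k0.+1 - a) = false by apply: (@w_gap w O K gal (k0)); clear -g0 a2; lia.
have w2 : w (O k1.+1).-1 = false by apply: (@w_gap w O K gal (k1)); clear -h a2; lia.
have w3 := w_O gal k.+1; have w4 := w_O gal k'.+1.
apply: (no_four_returns good R1 R2 R3 R4).
- by apply: block_neq_size; rewrite subSnn; clear -h a2; lia.
- by apply: block_neq_head; rewrite ?subSnn // w1 w3.
- by apply: block_neq_head; rewrite ?subSnn // w1 w4.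
- by apply: block_neq_head; rewrite ?w2 ?w3 //; clear; lia.
- by apply: block_neq_head; rewrite ?w2 ?w4 //; clear; lia.
- by apply: block_neq_size; clear -d g g'; lia.
Qed.

End IsolatedGaps.

Lemma rd_gal w O z r : run_decomposition w O z r -> (forall i, r i = 1) ->
  forall k n, (n <= O k) = (ones w n <= ones w (O 0) + k).
Proof.
move=> rd r1; have onesO k : ones w (O k) = ones w (O 0) + k.
  elim: k => [|k IH]; first by rewrite addn0.
  have -> : O k.+1 = (O k).+1 + z k by rewrite (rdS rd) r1; lia.
  have -> : ones w ((O k).+1 + z k) = ones w (O k).+1.
    by apply/ones_flatP => x xz; apply: (rd_zeros rd (i := k)); lia.
  by rewrite onesS (rd_end rd) IH; lia.
move=> k n; rewrite -onesO; apply/idP/idP => [nk|].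
  by case/andP: (ones_mono w nk).
apply: contraTT; rewrite -!ltnNge => kn.
by have /andP[] := ones_mono w kn; rewrite onesS (rd_end rd); lia.
Qed.

(** * Isolated 1s with two distances differing by at least 2 *)

Section IsolatedOnes.
Variables (w : infinite_word bool) (O z r : nat -> nat) (a b : nat).
Hypothesis rw : recurrent w.
Hypothesis good : two_or_three_returns w.
Hypothesis rd : run_decomposition w O z r.
Hypothesis r1 : forall i, r i = 1.
Hypothesis zab : forall i, (z i).+1 = a \/ (z i).+1 = b.
Hypothesis a2 : 2 <= a.
Hypothesis ab : a + 2 <= b.
Hypothesis exA : exists i, (z i).+1 = a.
Hypothesis exB : exists i, (z i).+1 = b.

Let B i := (z i).+1 == b.
Let gal := rd_gal rd r1.

Lemma iso_S k : O k.+1 = O k + (if B k then b else a).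
Proof. by rewrite (rdS rd) r1 /B; case: eqP; have := zab k; lia. Qed.

Lemma iso_short i : (B i = false) <-> (z i).+1 = a.
Proof. by rewrite /B; case: eqP; have := zab i; lia. Qed.

Lemma iso_long i : (B i = true) <-> (z i).+1 = b.
Proof. by rewrite /B; case: eqP; have := zab i; split. Qed.

Lemma iso_pattern i L k : exists2 i', k <= i' & forall y, y < L -> B (i' + y) = B (i + y).
Proof.
have [i' ki' h] := rd_pattern rw rd i L k; exists i' => // y yL.
by rewrite /B (h y yL).1.
Qed.

Lemma iso_recurs c k : (exists i, B i = c) -> exists2 i, k <= i & B i = c.
Proof.
move=> [i Bi]; have [i' ki' h] := iso_pattern i 1 k; exists i' => //.
by have := h 0 isT; rewrite !addn0 Bi.
Qed.

Lemma iso_exists c : exists i, B i = c.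
Proof.
by case: c; [have [i /iso_long] := exB|have [i /iso_short] := exA]; exists i.
Qed.

(** The two spacings supplied by [two_long_runs] both exceed 1, hence give two sizes of stretches of
    short gaps between long ones. *)
Lemma isolated_no_long_pair : (forall i, ~ (B i = true /\ B i.+1 = true)) -> False.
Proof.
move=> no; have [||||] := @two_long_runs w O z r b.-1 a.-1 rw good rd.
- by move=> i; have := zab i; lia.
- by move=> i; have := zab i; lia.
- by move=> i j; rewrite !r1.
- by have [i /= e] := exB; exists i; lia.
move=> k [m [k' [m' [[k0 m0 k0' m0' mm] [[zk zm A] [zk' zm' A']]]]]].
have bl i : z i = b.-1 -> B i = true by move=> e; apply/iso_long; lia.
have sh i : z i <> b.-1 -> B i = false by move=> e; apply/iso_short; have := zab i; lia.
have m1 : m <> 1 by move=> e; apply: (no k); rewrite -addn1 -e; split; exact: bl.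
have m1' : m' <> 1 by move=> e; apply: (no k'); rewrite -addn1 -e; split; exact: bl.
have [t et] : exists t, k + m = t.+1 by exists (k + m).-1; lia.
have [t' et'] : exists t', k' + m' = t'.+1 by exists (k' + m').-1; lia.
rewrite et in zm A; rewrite et' in zm' A'.
have kt : k < t by lia.
have kt' : k' < t' by lia.
apply: (isolated_short_gaps rw good gal iso_S a2 ab kt kt'); try by apply: bl.
- by lia.
- by move=> q qk; apply: sh; apply: A; lia.
- by move=> q qk; apply: sh; apply: A'; lia.
Qed.

(** Length [a.+1] and weight 2 single out the block consisting of a short gap with its two 1s; its
    returns measure the stretches of long gaps. *)
Lemma short_gap_position n : O 0 < n -> ones w (n + a.+1) = ones w n + 2 ->
  exists2 q, n = O q.+1 & B q.+1 = false.
Proof.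
move=> n0 cn; have [q qn] := rd_locate rd n0.
have g := iso_S q.+1; have g' := iso_S q.+2.
have h : O q.+2 < n + a.+1 <= O q.+3.
  apply: contrapT => h; apply: (@not_weight_class w O _ gal q q.+2 n a.+1 2) => //; lia.
exists q; last by move: g h qn; case: (B _) => //; lia.
by move: g h qn; case: (B _); lia.
Qed.

Lemma short_gap_class q : B q.+1 = false -> ones w (O q.+1 + a.+1) = ones w (O q.+1) + 2.
Proof.
move=> Bq; have g := iso_S q.+1; have g' := iso_S q.+2; rewrite Bq in g.
have h := rd_ltS rd q; have h' := rd_ltS rd q.+2.
by apply: (@weight_class w O _ gal q q.+2); lia.
Qed.

Lemma short_gap_return i j : O 0 < i -> weight_return w a.+1 2 i j ->
  exists k m, [/\ i = O k.+1, j = O (k + m).+1, 0 < m &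
    [/\ B k.+1 = false, B (k + m).+1 = false & forall q, k < q < k + m -> B q.+1 = true]].
Proof.
move=> i0 [ij ci cj no].
have [k ik Bk] := short_gap_position i0 ci.
have [k' jk' Bk'] := short_gap_position (ltn_trans i0 ij) cj.
have kk' : k < k' by rewrite ltnNge -ltnS -(rd_le rd); apply/negP; have := rd_ltS rd k'; lia.
exists k, (k' - k); rewrite subnKC ?(ltnW kk') //; split=> //; [lia|split=> //].
move=> q /andP[kq qk]; apply/negPn/negP => /negbTE Bq.
apply: (no (O q.+1)); last exact: short_gap_class.
by rewrite ik jk' !(rd_lt rd).
Qed.

Lemma isolated_no_short_pair : (forall i, ~ (B i = false /\ B i.+1 = false)) -> False.
Proof.
move=> no.
have [i0 i01 Bi0] := iso_recurs 1 (iso_exists false).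
have [|[i [j [i' [j' [ri ri' d]]]]] _] := good (l := a.+1) (c := 2).
  exists (O i0); rewrite -(prednK i01); apply: short_gap_class.
  by rewrite prednK.
have [i1 [li1 ri1 b1]] := weight_return_recurs (O 0).+1 rw ri.
have [i2 [li2 ri2 b2]] := weight_return_recurs (O 0).+1 rw ri'.
have [k [m [ik jk m0 [Bk Bm A]]]] := short_gap_return li1 ri1.
have [k' [m' [ik' jk' m0' [Bk' Bm' A']]]] := short_gap_return li2 ri2.
have mm : m <> m'.
  move=> mm; apply: d; rewrite -b1 -b2.
  have [|e h] := @rd_same_word w O z r rd k.+1 k'.+1 m.
    move=> y ym; split; last by rewrite !r1.
    have [->|y0] : y = 0 \/ 0 < y by lia.
      by move: Bk Bk' => /iso_short Bk /iso_short Bk'; rewrite !addn0; lia.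
    have /iso_long : B (k + y).+1 = true by apply: A; lia.
    have /iso_long : B (k' + y).+1 = true by apply: A'; lia.
    by rewrite !addSn; lia.
  rewrite -mm in jk'; rewrite !addSn in e h.
  have ji : j - i = j' - i' by lia.
  by rewrite -ji; apply/eq_blockP => x xl; rewrite ik ik' h //; lia.
have m1 : m <> 1 by move=> e; apply: (no k.+1); rewrite Bk -[k.+2]addn1 addSn -e Bm.
have m1' : m' <> 1 by move=> e; apply: (no k'.+1); rewrite Bk' -[k'.+2]addn1 addSn -e Bm'.
have [u eu] : exists u, k + m = u.+1 by exists (k + m).-1; lia.
have [u' eu'] : exists u', k' + m' = u'.+1 by exists (k' + m').-1; lia.
rewrite eu in Bm A; rewrite eu' in Bm' A'.
have ku : k < u by lia.
have ku' : k' < u' by lia.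
apply: (isolated_long_gaps good gal iso_S a2 ab ku ku') => //.
- by lia.
- by move=> [//|q] qk; apply: A; lia.
- by move=> [//|q] qk; apply: A'; lia.
- by case Bu: (B u.+3) => //; case: (no u.+2).
Qed.

Lemma isolated_ones_false : False.
Proof.
case: (pselect (exists i, B i = true /\ B i.+1 = true)) => [[i2 [Bi2 Bi2']]|h]; last first.
  by apply: isolated_no_long_pair => i hi; apply: h; exists i.
case: (pselect (exists i, B i = false /\ B i.+1 = false)) => [[i3 [Bi3 Bi3']]|h]; last first.
  by apply: isolated_no_short_pair => i hi; apply: h; exists i.
have [k2 k21 h2] := iso_pattern i2 2 1.
have Bk2 : B k2.-1.+1 = true.
  by rewrite prednK //; have := h2 0 isT; rewrite !addn0 Bi2.
have Bk2' : B k2.-1.+2 = true.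
  by rewrite prednK //; have := h2 1 isT; rewrite !addn1 Bi2'.
(* The last long gap before a pair of short gaps is followed by two short gaps. *)
have [kB kB1 BkB] := iso_recurs 1 (iso_exists true).
have [kA kA1 h3] := iso_pattern i3 2 kB.
have AkA : B kA = ~~ true by have := h3 0 isT; rewrite !addn0 Bi3.
have AkA' : B kA.+1 = ~~ true by have := h3 1 isT; rewrite !addn1 Bi3'.
have [k3 [k31 k3A Bk3 A3]] := last_occurrence (leqW kA1) BkB AkA'.
have k3A' : k3 < kA.
  rewrite ltnNge; apply/negP => h; have e : k3 = kA by clear -h k3A; lia.
  by rewrite e AkA in Bk3.
have k30 : k3 = k3.-1.+1 by clear -k31 kB1; lia.
apply: (@isolated_mixed w O _ a b B rw good gal iso_S a2 ab k3.-1 k2.-1 k3) => //.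
- by rewrite -k30.
- by rewrite -k30 A3 //; clear -k3A'; lia.
- by rewrite A3 //; clear -k3A'; lia.
- by rewrite A3 //; clear -k3A'; lia.
Qed.

End IsolatedOnes.

(** * Words with two or three returns are balanced *)

(** Since N 0s in a row occur, shorter blocks hold at most one 1: the 1s are isolated, at distance
    at least [N.-1]. The block at [m] realises [N.-1], and the one at [n] a distance at least
    [N.-1 + 2]. *)
Lemma constant_zero_false w N n m : recurrent w -> two_or_three_returns w ->
  (forall l n m, l < N -> ones w (n + l) + ones w m <= ones w (m + l) + ones w n + 1) ->
  unbalanced_at w N n m -> 2 < N ->
  (forall x, 0 < x < N.-1 -> w (m + x) = false) -> False.
Proof.
move=> rw good Nmin un N3 inner.
have [wn wm wnN wmN] := unbalanced_ends Nmin un.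
have zn x : x < N -> w (n + x) = false.
  move=> xN; have [->|x0] : x = 0 \/ 0 < x by lia.
    by rewrite addn0.
  have [->//|xN'] : x = N.-1 \/ x < N.-1 by lia.
  by rewrite (unbalanced_inner Nmin un) ?inner //; lia.
have flat l : l <= N -> ones w (n + l) = ones w n.
  by move=> lN; apply/ones_flatP => x xl; apply: zn; lia.
have heavy p l : l < N -> ones w (p + l) <= ones w p + 1.
  by move=> lN; have := Nmin l p n lN; rewrite flat; lia.
have [||O [z [r rd]]] := run_decomposition_exists rw; [by exists n|by exists m|].
have r1 i : r i = 1.
  apply/eqP; rewrite eqn_leq (rd_r0 rd) andbT leqNgt; apply/negP => r2.
  have g := rdS rd i; have := heavy (O i + z i).+1 2 N3.
  rewrite addn2 (onesS _ (O i + z i).+2) (onesS _ (O i + z i).+1).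
  by rewrite !(rd_ones rd (i := i)) /=; lia.
have zN i : N.-1 <= (z i).+1.
  rewrite leqNgt; apply/negP => lt; have g := rdS rd i; have ri := rd_r0 rd i.
  have wz : w (O i + z i).+1 = true by apply: (rd_ones rd (i := i)); lia.
  have := heavy (O i) (z i).+2; rewrite !addnS (onesS _ (O i + z i).+1) wz.
  have -> : ones w (O i + z i).+1 = (ones w (O i)).+1.
    rewrite -addSn (_ : ones w ((O i).+1 + z i) = ones w (O i).+1).
      by rewrite onesS (rd_end rd) addn1.
    by apply/ones_flatP => x xz; apply: (rd_zeros rd (i := i)); lia.
  by rewrite /=; lia.
have a2 : 2 <= N.-1 by lia.
have gap k : O k + N.-1 <= O k.+1 by rewrite (rdS rd) r1; have := zN k; lia.
have gal := rd_gal rd r1.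
have [iA zA] : exists i, (z i).+1 = N.-1.
  have [m' mm' e] := recurrentP rw m N (O 0).
  have [i mi] : exists i, m' = O i.
    apply: (rd_end_index rd) => //.
      by have := e 0; rewrite !addn0 wm => -> //; lia.
    by have := e 1; rewrite !addn1 => ->; [rewrite -addn1 inner|]; lia.
  exists i; have := zN i; have [//|lt _] : (z i).+1 = N.-1 \/ (z i).+1 <> N.-1 by lia.
  have := e N.-1; rewrite wmN mi (rd_zeros rd (i := i)); last by have := zN i; lia.
  by move=> H; have : false = true by apply: H; lia.
have [iB zB] : exists i, N.-1 + 2 <= (z i).+1.
  have [n' nn' e] := recurrentP rw n N (O 0).+1.
  have [||q [q1 q2]] := rd_zero_run (n := n') (l := N) rd nn'; first by lia.
    by move=> x xN; rewrite e // zn.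
  by exists q; lia.
have shift i : exists i', z i'.+1 = z i.
  have [i' i'1 h] := rd_pattern rw rd i 1 1; exists i'.-1; rewrite prednK //.
  by have := h 0 isT; rewrite !addn0 => -[].
have gz k : O k.+1 = O k + (z k).+1 by rewrite (rdS rd) r1; lia.
have zab i : (z i).+1 = N.-1 \/ (z i).+1 = (z iB).+1.
  have [|gt] : (z i).+1 = N.-1 \/ N.-1 < (z i).+1 by have := zN i; lia.
    by left.
  right; have [j zj] := shift i; have [j' zj'] := shift iB; have [k1 zk1] := shift iA.
  have := @at_most_two_gaps w O _ N.-1 gal a2 gap iB k1 j j' good.
  rewrite !gz zj zj' zk1 zA; lia.
apply: (@isolated_ones_false w O z r N.-1 (z iB).+1) => //.
- by exists iA.
- by exists iB.
Qed.

Definition full_run w b l n :=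
  [/\ w n = ~~ b, forall x, 0 < x <= l -> w (n + x) = b & w (n + l.+1) = ~~ b].

(* The blocks 01 and 10 occur at both ends of a run, and not inside it. *)
Lemma full_run_return w b l n : 0 < l -> full_run w b l n ->
  weight_return w 2 1 n (n + l).
Proof.
move=> l0 [wn wb wl]; have w1 := wb 1; have wl' := wb l.
split; first by lia.
- by rewrite !addnS addn0 !onesS wn -addn1 w1 //; case: (b) => /=; lia.
- rewrite !addnS addn0 !onesS -addnS wl wl' ?l0 ?leqnn //; case: (b) => /=; lia.
move=> k /andP[nk kl]; have := wb (k - n); have := wb (k.+1 - n).
rewrite !subnKC ?(leqW (ltnW nk)) ?(ltnW nk) // !addnS addn0 !onesS => -> //; last by lia.
by move=> ->; [case: (b) => /=|]; lia.
Qed.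

(** The return given by a run is the opposite letter followed by all but one letter of the run, so
    it reveals both the letter and the length. *)
Lemma two_run_lengths w l l' p p' n n' k k' : two_or_three_returns w ->
  0 < l -> 0 < l' -> 0 < p -> 0 < p' -> l <> l' -> p <> p' ->
  full_run w true l n -> full_run w true l' n' ->
  full_run w false p k -> full_run w false p' k' -> False.
Proof.
move=> good l0 l0' p0 p0' ll pp f1 f2 f3 f4.
have [w1 _ _] := f1; have [w2 _ _] := f2; have [w3 _ _] := f3; have [w4 _ _] := f4.
apply: (no_four_returns good (full_run_return l0 f1) (full_run_return l0' f2)
  (full_run_return p0 f3) (full_run_return p0' f4)); rewrite ?addKn.
- exact: block_neq_size.
- by apply: block_neq_head; rewrite // w1 w3.
- by apply: block_neq_head; rewrite // w1 w4.
- by apply: block_neq_head; rewrite // w2 w3.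
- by apply: block_neq_head; rewrite // w2 w4.
- exact: block_neq_size.
Qed.

Lemma three_run_lengths w l p p' p'' n k k' k'' : two_or_three_returns w ->
  0 < l -> 0 < p -> 0 < p' -> 0 < p'' -> p <> p' -> p <> p'' -> p' <> p'' ->
  full_run w true l n ->
  full_run w false p k -> full_run w false p' k' -> full_run w false p'' k'' -> False.
Proof.
move=> good l0 p0 p0' p0'' pp pp' pp'' f1 f2 f3 f4.
have [w1 _ _] := f1; have [w2 _ _] := f2; have [w3 _ _] := f3; have [w4 _ _] := f4.
apply: (no_four_returns good (full_run_return l0 f1) (full_run_return p0 f2)
  (full_run_return p0' f3) (full_run_return p0'' f4)); rewrite ?addKn;
  try exact: block_neq_size.
- by apply: block_neq_head; rewrite // w1 w2.
- by apply: block_neq_head; rewrite // w1 w3.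
- by apply: block_neq_head; rewrite // w1 w4.
Qed.

(** The common length of the runs of 1s is at least 2, and [three_run_lengths] leaves at most two
    lengths for the 0s. Two adjacent long runs lead to [runs_mixed]; otherwise two spacings of long
    runs lead to [runs_short]. *)
Lemma constant_runs_false w n m : recurrent w -> two_or_three_returns w ->
  (forall l l' k k', 0 < l -> 0 < l' -> full_run w true l k -> full_run w true l' k' ->
     l = l') ->
  w n = false -> w n.+1 = false -> w m = true -> w m.+1 = true -> False.
Proof.
move=> rw good same wn wn' wm wm'.
have [||O [z [r rd]]] := run_decomposition_exists rw; [by exists n|by exists m|].
have fr i : full_run w true (r i) (O i + z i).
  have g := rdS rd i; have z0 := rd_z0 rd i; split.
  - by apply: (rd_zeros rd (i := i)); lia.
  - by move=> x xr; apply: (rd_ones rd (i := i)); lia.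
  - by rewrite addnS -g (rd_endS rd).
have fz i : full_run w false (z i) (O i).
  have g := rdS rd i; have r0 := rd_r0 rd i; split; first exact: rd_end rd i.
  - by move=> x xz; apply: (rd_zeros rd (i := i)); lia.
  - by apply: (rd_ones rd (i := i)); lia.
have rc i j : r i = r j by apply: same (fr i) (fr j); exact: rd_r0 rd _.
have r2 : 2 <= r 0.
  have [m' mm' e] := recurrentP rw m 2 (O 0).+1.
  have e0 : w m' = true by have := e 0 isT; rewrite !addn0 wm.
  have e1 : w m'.+1 = true by have := e 1 isT; rewrite !addn1 wm'.
  have [q q1] := rd_locate rd mm'; rewrite (rc 0 q); have g := rdS rd q.
  have h1 : O q + z q < m'.
    by rewrite ltnNge; apply/negP => h; rewrite (rd_zeros rd (i := q)) in e0; lia.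
  have h2 : m' <> O q.+1 by move=> h; rewrite h (rd_endS rd) in e1.
  by lia.
have [iz z2] : exists i, 2 <= z i.
  have [n' nn' e] := recurrentP rw n 2 (O 0).+1.
  have [||q [q1 q2]] := rd_zero_run (n := n') (l := 2) rd nn'; first by lia.
    by move=> [|[|//]] x2; rewrite e // ?addn0 ?addn1.
  by exists q; lia.
have [s [t [s1 st zts [it zt]]]] : exists s t, [/\ 1 <= s, s < t,
    forall i, z i = t \/ z i = s & exists i, z i = t].
  case: (pselect (exists i j, z i < z j)) => [[i [j ij]]|h]; last first.
    (* When all runs of 0s have the same length, [s] is a mere placeholder below [t]. *)
    exists 1, (z iz); split=> //; last by exists iz.
    move=> i; left; case: (ltngtP (z i) (z iz)) => // lt; case: h.
      by exists i, iz.
    by exists iz, i.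
  exists (z i), (z j); split=> //; [exact: rd_z0 rd i| |by exists j].
  move=> k; have [->|n1] : z k = z j \/ z k <> z j by lia.
    by left.
  have [->|n2] : z k = z i \/ z k <> z i by lia.
    by right.
  exfalso; apply: (three_run_lengths good (rd_r0 rd 0) (rd_z0 rd k) (rd_z0 rd j) (rd_z0 rd i)
    _ _ _ (fr 0) (fz k) (fz j) (fz i)) => //; lia.
have [||||k [m1 [k' [m2 [[k0 m10 k0' m20 mm] [[zk zm A] [zk' zm' A']]]]]]] :=
  @two_long_runs w O z r t s rw good rd => //.
- by move=> i; case: (zts i) => ->; lia.
- by exists it.
pose B i := z i == t.
have zE i : z i = if B i then t else s by rewrite /B; case: eqP; case: (zts i).
have OS i : O i.+1 = O i + (if B i then t else s) + r 0 by rewrite -zE (rdS rd) (rc i 0).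
have hz i p : O i < p <= O i + (if B i then t else s) -> w p = false.
  by rewrite -zE; exact: rd_zeros rd i p.
have ho i p : O i + (if B i then t else s) < p <= O i.+1 -> w p = true.
  by rewrite -zE; exact: rd_ones rd i p.
have Bt i : z i = t -> B i = true by move=> e; rewrite /B e eqxx.
have Bf i : z i <> t -> B i = false by rewrite /B => /eqP/negbTE.
case: (pselect (exists i, B i = true /\ B i.+1 = true)) => [[i [Bi Bi']]|no].
  have pat j L q : exists2 j', q <= j' & forall y, y < L -> B (j' + y) = B (j + y).
    have [j' qj h] := rd_pattern rw rd j L q; exists j' => // y yL.
    by rewrite /B (h y yL).1.
  have rec j q : exists2 j', q <= j' & B j' = B j.
    have [j' qj h] := pat j 1 q; exists j' => //.
    by have := h 0 isT; rewrite !addn0.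
  (* Of two different spacings one exceeds 1, so a run that is not long lies in between. *)
  have [iA BA] : exists i, B i = false.
    have [h|h] : 1 < m1 \/ 1 < m2 by lia.
      by exists k.+1; apply: Bf; apply: A; lia.
    by exists k'.+1; apply: Bf; apply: A'; lia.
  have [j1 j11 h1] := pat i 2 1.
  have B1 : B j1.-1.+1 = true.
    by rewrite prednK //; have := h1 0 isT; rewrite !addn0 Bi.
  have B1' : B j1.-1.+2 = true.
    by rewrite prednK //; have := h1 1 isT; rewrite !addn1 Bi'.
  have [j2 j12 h2] := rec iA j1; have [j3 j23 h3] := rec i j2.
  rewrite BA in h2; rewrite Bi in h3; rewrite prednK // in B1.
  have [p [jp pj Bp Ap]] := last_occurrence j12 B1 h2.
  have [q [jq qj Bq Aq]] := last_occurrence j23 h2 h3.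
  have p1 : p = p.-1.+1 by clear -jp j11; lia.
  have q1 : q = q.-1.+1 by clear -jq j12 j11; lia.
  apply: (@runs_mixed w O (r 0) s t B rw good OS hz ho r2 s1 st q.-1 j1.-1 p.-1) => //.
  - by rewrite -q1.
  - by rewrite -q1 Aq //; clear -qj; lia.
  - by rewrite prednK.
  - by rewrite -p1.
  - by rewrite -p1 Ap //; clear -pj; lia.
have ne q p : z q = t -> z (q + p) = t -> p <> 1.
  by move=> zq zp e; apply: no; exists q; rewrite -addn1 -e; split; exact: Bt.
have m11 := ne _ _ zk zm; have m21 := ne _ _ zk' zm'.
have [u eu] : exists u, k = u.+1 by exists k.-1; lia.
have [u' eu'] : exists u', k' = u'.+1 by exists k'.-1; lia.
have [v ev] : exists v, k + m1 = v.+2 by exists (k + m1 - 2); lia.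
have [v' ev'] : exists v', k' + m2 = v'.+2 by exists (k' + m2 - 2); lia.
rewrite ev in zm A; rewrite ev' in zm' A'; rewrite eu in zk A; rewrite eu' in zk' A'.
have uv : u < v by lia.
have uv' : u' < v' by lia.
apply: (@runs_short w O (r 0) s t B rw good OS hz ho r2 s1 st u v u' v') => //.
- by lia.
- exact: Bt.
- exact: Bt.
- by move=> q qu; apply: Bf; apply: A; lia.
- exact: Bt.
- exact: Bt.
- by move=> q qu; apply: Bf; apply: A'; lia.
Qed.

Lemma two_or_three_balanced w : recurrent w -> two_or_three_returns w -> balanced w.
Proof.
move=> rw good; apply: contrapT => nb.
have [N [[n [m un]] Nmin]] := minimal_unbalanced nb.
have N2 := unbalanced_size un.
have [wn wm wnN wmN] := unbalanced_ends Nmin un.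
have rw' := recurrent_complement rw; have good' := two_or_three_complement good.
(* For [N = 2] the inner word is empty and 00 and 11 both occur. By [two_run_lengths] one of the
   letters then has a single run length, and the letters are exchanged when that letter is 0. *)
have [e|N3] : N = 2 \/ 2 < N by lia.
  rewrite e /= !addn1 in wnN wmN.
  case: (pselect (exists l l' k k', [/\ 0 < l, 0 < l', l <> l',
    full_run w true l k & full_run w true l' k'])) => [[l [l' [k [k' [l0 l0' ll f f']]]]]|h].
    apply: (@constant_runs_false (complement w) m n) => //; rewrite /complement ?wn ?wm ?wnN ?wmN //.
    have back p q : full_run (complement w) true p q -> full_run w false p q.
      move=> [h1 h2 h3]; split; [exact: negb_inj h1| |exact: negb_inj h3].
      by move=> x /h2 /negbTE.
    move=> p p' q q' p0 p0' /back a1 /back a2; apply: contrapT => pp.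
    exact: (two_run_lengths good l0 l0' p0 p0' ll pp f f' a1 a2).
  apply: (@constant_runs_false w n m) => // l l' k k' l0 l0' f f'.
  by apply: contrapT => ll; apply: h; exists l, l', k, k'.
have [b hb] := unbalanced_constant rw good Nmin un.
case: b hb => hb; last exact: constant_zero_false Nmin un N3 hb.
apply: (@constant_zero_false (complement w) N m n) => //.
- move=> l a c lN; move: (Nmin l c a lN) (ones_complement w a) (ones_complement w c).
  move: (ones_complement w (a + l)) (ones_complement w (c + l)); lia.
- move: un (ones_complement w n) (ones_complement w m).
  move: (ones_complement w (n + N)) (ones_complement w (m + N)).
  rewrite /unbalanced_at; lia.
- by move=> x xN; rewrite /complement (unbalanced_inner Nmin un) ?hb.
Qed.

(* The letters 0 and 1 are false and true. *)
Theorem theorem3 (w : infinite_word bool) (hw : recurrent w) :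
  sturmian w <->
  (forall u : seq bool, factor w u ->
     semi_abelian_returns w u #= `I_2 \/ semi_abelian_returns w u #= `I_3).
Proof.
rewrite -two_or_three_returnsP; split; first exact: sturmian_two_or_three.
by move=> good; apply: balanced_sturmian => //; exact: two_or_three_balanced.
Qed.
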